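(* For any $\epsilon > 0$, any integer $k \ge 5$, and any slopes $s_i \in \mathbf{Q}\cup\{\infty\}$ ($i \in \mathbf{Z}/k\mathbf{Z}$) with $s_i \ne s_{i+1}$ for all $i\in\mathbf{Z}/k\mathbf{Z}$, there exists $\delta > 0$ such that the following holds. Let $n\ge1$ be an integer and let $S \subset \{1,\ldots,n\}\times\{1,\ldots,n\}$ satisfy (i) $|S| \ge \epsilon n^{3/2}$, (ii) for each $i \in \mathbf{Z}/k\mathbf{Z}$, $S$ contains at most $\delta |S|^4/n^4$ non-degenerate $(s_i, s_{i+1}, s_i, s_{i+1})$-polygons. Then $S$ contains at least $\delta |S|^k/n^k$ (possibly degenerate) $(s_1,\ldots,s_k)$-polygons.
   Context: Given slopes $t_1,\ldots,t_m\in\mathbf{Q}\cup\{\infty\}$, a sequence of lattice points $(p_1,\ldots,p_m)\in(\mathbf{Z}^2)^m$ is a $(t_1,\ldots,t_m)$-polygon if for each $i\in\mathbf{Z}/m\mathbf{Z}$, the points $p_i$ and $p_{i+1}$ lie on a line of slope $t_i$ (this holds automatically when $p_i=p_{i+1}$; slope $\infty$ means a vertical line). It is non-degenerate if $p_1,\ldots,p_m$ are pairwise distinct. $S$ contains the polygon if $p_1,\ldots,p_m\in S$. *)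

(* Defs.v *)
From HB Require Import structures.
From mathcomp Require Import all_boot all_order all_algebra finmap.

Set Implicit Arguments.
Unset Strict Implicit.
Unset Printing Implicit Defensive.

Import Order.TTheory GRing.Theory Num.Theory.
Local Open Scope ring_scope.

(* Slopes in Q ∪ {∞}: [Some r] is the rational slope r, [None] is ∞. *)
Definition slope : Type := option rat.

Definition point : Type := (int * int)%type.

(* The line of slope [t] with parameter [c]: y = r x + c, or x = c if [t] is
   ∞. The parameter of a line of slope [t] through a lattice point is rational,
   so it is enough to let [c] range over [rat]. *)
Definition on_line (t : slope) (c : rat) (p : point) : bool :=
  if t is Some r then p.2%:~R == r * p.1%:~R + c else p.1%:~R == c.

Definition same_line (t : slope) (p q : point) : bool :=
  if t is Some r then (q.2 - p.2)%:~R == r * (q.1 - p.1)%:~R else q.1 == p.1.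

Lemma same_lineP (t : slope) (p q : point) :
  reflect (exists c : rat, on_line t c p /\ on_line t c q) (same_line t p q).
Proof.
case: t => [r|] /=; apply: (iffP eqP).
- rewrite !intrD !intrN => h; exists (p.2%:~R - r * p.1%:~R).
  split; apply/eqP; first by rewrite addrC subrK.
  by rewrite addrCA -mulrBr -h addrC subrK.
- case=> c [/eqP hp /eqP hq].
  by rewrite !intrD !intrN hp hq opprD addrACA subrr addr0 mulrBr.
- by move=> ->; exists p.1%:~R.
- by case=> c [/eqP hp /eqP hq]; apply: (@intr_inj rat); rewrite hp hq.
Qed.

(* Indices in Z/m are elements of ['I_m]; [ordS] is i |-> i + 1 modulo m. *)
Definition is_polygon (m : nat) (t : 'I_m -> slope) (p : 'I_m -> point) : bool :=
  [forall i : 'I_m, same_line (t i) (p i) (p (ordS i))].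

Definition nondegenerate (m : nat) (p : 'I_m -> point) : bool := injectiveb p.

Definition polygons (S : {fset point}) (m : nat) (t : 'I_m -> slope) :
    {set {ffun 'I_m -> S}} :=
  [set p : {ffun 'I_m -> S} | is_polygon t (fun i => val (p i))].

Definition nondegenerate_polygons (S : {fset point}) (m : nat)
    (t : 'I_m -> slope) : {set {ffun 'I_m -> S}} :=
  [set p in polygons S t | nondegenerate (fun i => val (p i))].

(* Main.v *)
Require Import Defs.
From HB Require Import structures.
From mathcomp Require Import all_boot all_order all_algebra finmap.
From mathcomp Require Import reals exp.
From mathcomp Require Import boolp ring lra zify.

Set Implicit Arguments.
Unset Strict Implicit.
Unset Printing Implicit Defensive.

Import Order.TTheory GRing.Theory Num.Theory.
Local Open Scope ring_scope.

(** Lattice lines of the slopes [s i] are the vertices of a graph with O(n)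
    vertices, and the points of [S] are its edges, each joining the line of
    slope [s i] through the point to its line of slope [s (ordS i)].
    Quadrilaterals of [S] become 4-cycles and k-gons become closed walks of
    length k.  Every point gives a degenerate k-gon, and these closed walks are
    edge-disjoint, so it is enough to prove a removal lemma for k-cycles in
    graphs with N vertices, about [N^(3/2)] edges and few 4-cycles.

    Having few 4-cycles bounds the Schatten 4-norm of the adjacency matrix [A],
    and it prevents [A] from sending vectors concentrated on few vertices to
    long vectors ([spread]).  Hence averages of [A] over partitions of the
    vertices have bounded Frobenius norm in units of [sqrt N], and energy
    increments give partitions [q2] finer than [q1] such that [A - avg q2 A] is
    tiny in operator norm, even compared with the number of classes of [q1],
    while [avg q2 A - avg q1 A] is small in Frobenius norm.  After discarding
    the edges lying in sparse, irregular or small pairs of classes of [q1],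
    some degenerate k-gon survives.  Along its classes, closed walks of [A] are
    counted by replacing [A] by [avg q2 A] one factor at a time: Hölder's
    inequality for the exponents (infinity, 4, 4, 4, 4) controls the error, and
    this is where k >= 5 is needed. *)

(** * Frobenius and operator norms of matrices *)

Section Frobenius.
Variable R : rcfType.
Implicit Types m n p : nat.

Definition dotm m n (M P : 'M[R]_(m, n)) : R := \sum_i \sum_j M i j * P i j.
Definition fnorm m n (M : 'M[R]_(m, n)) : R := Num.sqrt (dotm M M).

Lemma dotmE m n (M P : 'M[R]_(m, n)) : dotm M P = \tr (M^T *m P).
Proof.
rewrite /dotm /mxtrace exchange_big; apply: eq_bigr => j _; rewrite mxE.
by apply: eq_bigr => i _; rewrite mxE.
Qed.

Lemma dotmC m n (M P : 'M[R]_(m, n)) : dotm M P = dotm P M.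
Proof. by apply: eq_bigr => i _; apply: eq_bigr => j _; rewrite mulrC. Qed.

Lemma dotmDl m n (M M' P : 'M[R]_(m, n)) : dotm (M + M') P = dotm M P + dotm M' P.
Proof.
rewrite /dotm -big_split; apply: eq_bigr => i _; rewrite -big_split.
by apply: eq_bigr => j _; rewrite mxE mulrDl.
Qed.

Lemma dotmNl m n (M P : 'M[R]_(m, n)) : dotm (- M) P = - dotm M P.
Proof.
rewrite /dotm -sumrN; apply: eq_bigr => i _; rewrite -sumrN.
by apply: eq_bigr => j _; rewrite mxE mulNr.
Qed.

Lemma dotmZl m n (a : R) (M P : 'M[R]_(m, n)) : dotm (a *: M) P = a * dotm M P.
Proof.
rewrite /dotm mulr_sumr; apply: eq_bigr => i _; rewrite mulr_sumr.
by apply: eq_bigr => j _; rewrite mxE mulrA.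
Qed.

Lemma dotmBl m n (M M' P : 'M[R]_(m, n)) : dotm (M - M') P = dotm M P - dotm M' P.
Proof. by rewrite dotmDl dotmNl. Qed.

Lemma dotmDr m n (M P P' : 'M[R]_(m, n)) : dotm M (P + P') = dotm M P + dotm M P'.
Proof. by rewrite !(dotmC M) dotmDl. Qed.

Lemma dotmZr m n (a : R) (M P : 'M[R]_(m, n)) : dotm M (a *: P) = a * dotm M P.
Proof. by rewrite !(dotmC M) dotmZl. Qed.

Lemma dotmBr m n (M P P' : 'M[R]_(m, n)) : dotm M (P - P') = dotm M P - dotm M P'.
Proof. by rewrite !(dotmC M) dotmBl. Qed.

Lemma dotm_tr m n (M P : 'M[R]_(m, n)) : dotm M^T P^T = dotm M P.
Proof.
by rewrite /dotm exchange_big; apply: eq_bigr => i _; apply: eq_bigr => j _; rewrite !mxE.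
Qed.

Lemma dotm_mull m n p (P : 'M[R]_(m, p)) (M : 'M[R]_(p, n)) (Q : 'M[R]_(m, n)) :
  dotm (P *m M) Q = dotm M (P^T *m Q).
Proof. by rewrite !dotmE trmx_mul mulmxA. Qed.

Lemma dotm_mulr m n p (M : 'M[R]_(m, p)) (P : 'M[R]_(p, n)) (Q : 'M[R]_(m, n)) :
  dotm (M *m P) Q = dotm M (Q *m P^T).
Proof. by rewrite -dotm_tr trmx_mul dotm_mull -dotm_tr !trmx_mul !trmxK. Qed.

Lemma dotm_sqr_ge0 m n (M : 'M[R]_(m, n)) : 0 <= dotm M M.
Proof. by apply: sumr_ge0 => i _; apply: sumr_ge0 => j _; rewrite -expr2 sqr_ge0. Qed.

Lemma fnorm_ge0 m n (M : 'M[R]_(m, n)) : 0 <= fnorm M.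
Proof. exact: sqrtr_ge0. Qed.

Lemma fnorm2 m n (M : 'M[R]_(m, n)) : fnorm M ^+ 2 = dotm M M.
Proof. by rewrite sqr_sqrtr ?dotm_sqr_ge0. Qed.

Lemma fnorm_tr m n (M : 'M[R]_(m, n)) : fnorm M^T = fnorm M.
Proof. by rewrite /fnorm dotm_tr. Qed.

Lemma fnorm_le m n (M : 'M[R]_(m, n)) (a : R) :
  0 <= a -> dotm M M <= a ^+ 2 -> fnorm M <= a.
Proof. by move=> a0 h; rewrite -(ler_pXn2r (n := 2)) ?nnegrE ?fnorm_ge0 // fnorm2. Qed.

Lemma fnorm_eq0 m n (M : 'M[R]_(m, n)) : fnorm M = 0 -> M = 0.
Proof.
move=> h; have : dotm M M = 0 by rewrite -fnorm2 h expr0n.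
move/eqP; rewrite psumr_eq0 => [/allP hi|i _]; last first.
  by apply: sumr_ge0 => j _; rewrite -expr2 sqr_ge0.
apply/matrixP => i j; rewrite mxE.
move: (hi i (mem_index_enum _)) => /=; rewrite psumr_eq0; last first.
  by move=> j' _; rewrite -expr2 sqr_ge0.
by move=> /allP /(_ j (mem_index_enum _)) /=; rewrite -expr2 sqrf_eq0 => /eqP.
Qed.

Lemma fnormZ m n (a : R) (M : 'M[R]_(m, n)) : fnorm (a *: M) = `|a| * fnorm M.
Proof. by rewrite /fnorm dotmZl dotmZr mulrA -expr2 sqrtrM ?sqr_ge0 // sqrtr_sqr. Qed.

Lemma fnormN m n (M : 'M[R]_(m, n)) : fnorm (- M) = fnorm M.
Proof. by rewrite -scaleN1r fnormZ normrN1 mul1r. Qed.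

Lemma fnorm0 m n : fnorm (0 : 'M[R]_(m, n)) = 0.
Proof. by rewrite -(scale0r 0) fnormZ normr0 mul0r. Qed.

(** Cauchy-Schwarz, read off from the nonnegativity of the squared norm of
    [fnorm P *: M - fnorm M *: P]. *)
Lemma dotm_le m n (M P : 'M[R]_(m, n)) : dotm M P <= fnorm M * fnorm P.
Proof.
have [/fnorm_eq0 ->|M0] := eqVneq (fnorm M) 0.
  by rewrite fnorm0 mul0r -(scale0r 0) dotmZl mul0r.
have [/fnorm_eq0 ->|P0] := eqVneq (fnorm P) 0.
  by rewrite fnorm0 mulr0 -(scale0r 0) dotmZr mul0r.
have Mp : 0 < fnorm M by rewrite lt_def M0 fnorm_ge0.
have Pp : 0 < fnorm P by rewrite lt_def P0 fnorm_ge0.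
have := dotm_sqr_ge0 (fnorm P *: M - fnorm M *: P).
rewrite dotmBl !dotmBr !dotmZl !dotmZr -!fnorm2 (dotmC P M) => h.
have : 0 <= 2 * (fnorm M * fnorm P) * (fnorm M * fnorm P - dotm M P) by lra.
by rewrite pmulr_rge0 ?subr_ge0 // !mulr_gt0.
Qed.

Lemma ler_norm_dotm m n (M P : 'M[R]_(m, n)) : `|dotm M P| <= fnorm M * fnorm P.
Proof. by rewrite ler_norml dotm_le andbT lerNl -dotmNl -(fnormN M) dotm_le. Qed.

Lemma fnormD m n (M P : 'M[R]_(m, n)) : fnorm (M + P) <= fnorm M + fnorm P.
Proof.
apply: fnorm_le; first by rewrite addr_ge0 ?fnorm_ge0.
rewrite dotmDl !dotmDr -!fnorm2 (dotmC P M).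
by have := dotm_le M P; lra.
Qed.

Lemma fnormB m n (M P : 'M[R]_(m, n)) : fnorm (M - P) <= fnorm M + fnorm P.
Proof. by rewrite -(fnormN P) fnormD. Qed.

Lemma ler_fnorm m n (M P : 'M[R]_(m, n)) :
  (forall i j, `|M i j| <= P i j) -> fnorm M <= fnorm P.
Proof.
move=> h; apply: fnorm_le; rewrite ?fnorm_ge0 ?fnorm2 //.
apply: ler_sum => i _; apply: ler_sum => j _.
by rewrite -!expr2 -[M i j ^+ 2]real_normK ?num_real // lerXn2r ?nnegrE ?(le_trans _ (h i j)).
Qed.

Lemma dotm_col m n (M P : 'M[R]_(m, n)) : dotm M P = \sum_j dotm (col j M) (col j P).
Proof.
rewrite /dotm exchange_big; apply: eq_bigr => j _; apply: eq_bigr => i _.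
by rewrite big_ord1 !mxE.
Qed.

Lemma mxtrace_mul_le m n (M : 'M[R]_(m, n)) (P : 'M[R]_(n, m)) :
  `|\tr (M *m P)| <= fnorm M * fnorm P.
Proof. by rewrite -{1}[M]trmxK -dotmE -(fnorm_tr M) ler_norm_dotm. Qed.

Lemma fnorm_mul m n p (M : 'M[R]_(m, n)) (P : 'M[R]_(n, p)) :
  fnorm (M *m P) <= fnorm M * fnorm P.
Proof.
apply: fnorm_le; first by rewrite mulr_ge0 ?fnorm_ge0.
rewrite exprMn !fnorm2 [dotm P P]dotm_col {2}/dotm mulr_suml.
apply: ler_sum => i _; rewrite mulr_sumr; apply: ler_sum => j _.
have -> : (M *m P) i j = dotm (row i M)^T (col j P).
  by rewrite mxE; apply: eq_bigr => l _; rewrite big_ord1 !mxE.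
have -> : \sum_j0 M i j0 * M i j0 = dotm (row i M)^T (row i M)^T.
  by apply: eq_bigr => l _; rewrite big_ord1 !mxE.
rewrite -!fnorm2 -exprMn -expr2 -[X in X <= _]real_normK ?num_real //.
by rewrite lerXn2r ?nnegrE ?mulr_ge0 ?fnorm_ge0 // ler_norm_dotm.
Qed.

(* [g] bounds the operator norm of [D]. *)
Definition opb m n (g : R) (D : 'M[R]_(m, n)) : Prop :=
  forall v : 'cV[R]_n, fnorm (D *m v) <= g * fnorm v.

(** The squared Frobenius norm is a sum over columns, and [opb] applies to each column. *)
Lemma opb_mull m n p (g : R) (D : 'M[R]_(m, n)) (M : 'M[R]_(n, p)) :
  0 <= g -> opb g D -> fnorm (D *m M) <= g * fnorm M.
Proof.
move=> g0 h; apply: fnorm_le; first by rewrite mulr_ge0 ?fnorm_ge0.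
rewrite exprMn !fnorm2 (dotm_col (D *m M)) (dotm_col M) mulr_sumr; apply: ler_sum => j _.
rewrite -!fnorm2 -exprMn lerXn2r ?nnegrE ?mulr_ge0 ?fnorm_ge0 //.
by rewrite colE -mulmxA -colE.
Qed.

(** The square of |D^T v| is <v, D D^T v>, at most |v| g |D^T v|; one factor |D^T v| cancels. *)
Lemma opb_tr m n (g : R) (D : 'M[R]_(m, n)) : 0 <= g -> opb g D -> opb g D^T.
Proof.
move=> g0 h v; have [->|D0] := eqVneq (fnorm (D^T *m v)) 0; first by rewrite mulr_ge0 ?fnorm_ge0.
have Dp : 0 < fnorm (D^T *m v) by rewrite lt_def D0 fnorm_ge0.
rewrite -(ler_pM2r Dp) -expr2 fnorm2 dotm_mull trmxK.
apply: le_trans (dotm_le _ _) _; rewrite mulrAC [leRHS]mulrC.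
by rewrite ler_wpM2l ?fnorm_ge0.
Qed.

Lemma opb_mulr m n p (g : R) (D : 'M[R]_(n, p)) (M : 'M[R]_(m, n)) :
  0 <= g -> opb g D -> fnorm (M *m D) <= g * fnorm M.
Proof.
move=> g0 h; rewrite -fnorm_tr trmx_mul -(fnorm_tr M).
by apply: opb_mull => //; apply: opb_tr.
Qed.

Lemma opb_comp m n p (g h : R) (D : 'M[R]_(m, n)) (D' : 'M[R]_(n, p)) :
  0 <= g -> opb g D -> opb h D' -> opb (g * h) (D *m D').
Proof.
move=> g0 hD hD' v; rewrite -mulmxA; apply: le_trans (hD _) _.
by rewrite -mulrA ler_wpM2l.
Qed.

(** By cyclicity of the trace, both squares equal the fourth power of the Schatten 4-norm of [M]. *)
Lemma fnorm_gram_tr n (M : 'M[R]_n) : fnorm (M *m M^T) = fnorm (M^T *m M).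
Proof.
by rewrite /fnorm !dotmE !trmx_mul !trmxK; congr Num.sqrt; rewrite -!mulmxA mxtrace_mulC !mulmxA.
Qed.

(* The Schatten 4-norm form of Hölder's inequality for two factors. *)
Lemma fnorm_mul_gram n (M P : 'M[R]_n) (a : R) :
  fnorm (M^T *m M) <= a -> fnorm (P^T *m P) <= a -> fnorm (M *m P) <= a.
Proof.
move=> hM hP; have a0 : 0 <= a by apply: le_trans (fnorm_ge0 _) hM.
apply: fnorm_le => //.
have -> : dotm (M *m P) (M *m P) = \tr ((M^T *m M) *m (P *m P^T)).
  transitivity (\tr (P^T *m (M^T *m M *m P))); first by rewrite dotmE trmx_mul !mulmxA.
  by rewrite mxtrace_mulC -!mulmxA.
apply: le_trans (ler_norm _) _; apply: le_trans (mxtrace_mul_le _ _) _.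
by rewrite expr2 ler_pM ?fnorm_ge0 // fnorm_gram_tr.
Qed.

End Frobenius.

(** * Averaging over a partition *)

Section Averaging.
Variables (R : rcfType) (N : nat).

Section OneColouring.
Variables (C : finType) (q : 'I_N -> C).

Definition cls (x : 'I_N) : R := #|[pred y | q y == q x]|%:R.

(** Conditional expectation: the orthogonal projection onto the vectors that are constant on the
    classes of [q]. Accordingly [avg A] replaces each entry by its mean over a pair of classes, see
    [avgE]. *)
Definition Emx : 'M[R]_N := \matrix_(x, y) ((q x == q y)%:R / cls x).

Definition avg (A : 'M[R]_N) : 'M[R]_N := Emx *m A *m Emx.

Lemma cls_eq x y : q x = q y -> cls x = cls y.
Proof. by move=> h; rewrite /cls; congr (_%:R); apply: eq_card => z; rewrite !inE h. Qed.

Lemma clsE x : cls x = \sum_y (q x == q y)%:R.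
Proof.
rewrite /cls -sum1_card natr_sum big_mkcond; apply: eq_bigr => y _.
by rewrite inE eq_sym; case: eqP.
Qed.

Lemma cls_ge1 x : 1 <= cls x.
Proof. by rewrite /cls ler1n; apply/card_gt0P; exists x; rewrite inE. Qed.

Lemma cls_gt0 x : 0 < cls x.
Proof. exact: lt_le_trans ltr01 (cls_ge1 x). Qed.

Lemma cls_neq0 x : cls x != 0.
Proof. by rewrite gt_eqF ?cls_gt0. Qed.

Lemma Emx_ge0 x y : 0 <= Emx x y.
Proof. by rewrite mxE divr_ge0 ?ler0n // ltW ?cls_gt0. Qed.

Lemma Emx_sym : Emx^T = Emx.
Proof.
apply/matrixP => x y; rewrite !mxE eq_sym; case: eqP => [h|_]; last by rewrite !mul0r.
by rewrite (cls_eq h).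
Qed.

Lemma Emx_row_sum x : \sum_y Emx x y = 1.
Proof.
under eq_bigr do rewrite mxE.
by rewrite -mulr_suml -clsE divff ?cls_neq0.
Qed.

Lemma Emx_mul_const p (M : 'M[R]_(N, p)) :
  (forall x y j, q x = q y -> M x j = M y j) -> Emx *m M = M.
Proof.
move=> h; apply/matrixP => x j; rewrite mxE.
transitivity (\sum_y Emx x y * M x j); last by rewrite -mulr_suml Emx_row_sum mul1r.
apply: eq_bigr => y _; rewrite mxE; case: eqP => [e|_]; last by rewrite !mul0r.
by rewrite (h _ _ _ e).
Qed.

Lemma Emx_const x y j : q x = q y -> Emx x j = Emx y j.
Proof. by move=> h; rewrite !mxE h (cls_eq h). Qed.

Lemma Emx_idem : Emx *m Emx = Emx.
Proof. by apply: Emx_mul_const => x y j; apply: Emx_const. Qed.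

Lemma Emx_opb : opb 1 Emx.
Proof.
move=> v; rewrite mul1r; have [->|h0] := eqVneq (fnorm (Emx *m v)) 0; first exact: fnorm_ge0.
have h : 0 < fnorm (Emx *m v) by rewrite lt_def h0 fnorm_ge0.
rewrite -(ler_pM2r h) -expr2 fnorm2 dotm_mull Emx_sym mulmxA Emx_idem.
exact: dotm_le.
Qed.

Lemma fnorm_Emxl p (M : 'M[R]_(N, p)) : fnorm (Emx *m M) <= fnorm M.
Proof. by rewrite -[leRHS]mul1r; apply: opb_mull => //; apply: Emx_opb. Qed.

Lemma fnorm_Emxr p (M : 'M[R]_(p, N)) : fnorm (M *m Emx) <= fnorm M.
Proof. by rewrite -[leRHS]mul1r; apply: opb_mulr => //; apply: Emx_opb. Qed.

Lemma avg_tr (A : 'M[R]_N) : (avg A)^T = avg A^T.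
Proof. by rewrite /avg !trmx_mul Emx_sym mulmxA. Qed.

Lemma avg_idem (A : 'M[R]_N) : avg (avg A) = avg A.
Proof. by rewrite /avg !mulmxA Emx_idem -!mulmxA Emx_idem. Qed.

Lemma avg_const (A : 'M[R]_N) x x' y y' :
  q x = q x' -> q y = q y' -> avg A x y = avg A x' y'.
Proof.
move=> hx hy; rewrite !mxE; apply: eq_bigr => j _; congr (_ * _).
  by rewrite !mxE; apply: eq_bigr => i _; rewrite (Emx_const _ hx).
by rewrite -Emx_sym mxE [in RHS]mxE (Emx_const _ hy).
Qed.

Lemma avg_ge0 (A : 'M[R]_N) x y : (forall i j, 0 <= A i j) -> 0 <= avg A x y.
Proof.
move=> h; rewrite !mxE; apply: sumr_ge0 => j _; rewrite mulr_ge0 ?Emx_ge0 // !mxE.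
by apply: sumr_ge0 => i _; rewrite mulr_ge0 ?Emx_ge0.
Qed.

Lemma dotm_avg (A B : 'M[R]_N) : dotm (avg A) B = dotm A (avg B).
Proof. by rewrite /avg dotm_mulr dotm_mull Emx_sym mulmxA. Qed.

Lemma avgE (A : 'M[R]_N) x y :
  avg A x y * (cls x * cls y) = \sum_(i | q x == q i) \sum_(j | q y == q j) A i j.
Proof.
rewrite mxE mulr_suml [RHS]big_mkcond /=.
transitivity (\sum_j \sum_i (q x == q i)%:R * ((q y == q j)%:R * A i j)).
  apply: eq_bigr => j _; rewrite mxE -mulrA mulr_suml; apply: eq_bigr => i _.
  rewrite !mxE (eq_sym (q j)); case: eqP => [e1|_]; last by rewrite !(mul0r, mulr0).
  case: eqP => [e2|_]; last by rewrite !(mul0r, mulr0).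
  by rewrite -(cls_eq e2) !mul1r; field; rewrite !cls_neq0.
rewrite exchange_big; apply: eq_bigr => i _; rewrite -mulr_sumr.
case: eqP => _; rewrite ?mul0r // mul1r [RHS]big_mkcond; apply: eq_bigr => j _.
by case: eqP; rewrite ?mul0r ?mul1r.
Qed.

Lemma sum_avg (A : 'M[R]_N) : \sum_x \sum_y avg A x y = \sum_x \sum_y A x y.
Proof.
have h (B : 'M[R]_N) : \sum_x \sum_y B x y = dotm B (const_mx 1).
  by apply: eq_bigr => x _; apply: eq_bigr => y _; rewrite mxE mulr1.
rewrite !h dotm_avg; congr dotm; rewrite /avg Emx_mul_const => [|x y j _]; last by rewrite !mxE.
rewrite -[const_mx 1]trmxK -Emx_sym -trmx_mul Emx_mul_const // => x y j _.
by rewrite !mxE.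
Qed.

(** Each nonempty class contributes exactly 1. *)
Lemma sum_inv_cls : \sum_x (cls x)^-1 <= #|C|%:R.
Proof.
rewrite (partition_big q xpredT) //= -sum1_card natr_sum; apply: ler_sum => c _.
have [x hx|h0] := pickP [pred x | q x == c]; last by rewrite big_pred0.
rewrite (eq_bigr (fun=> (cls x)^-1)) => [|y /eqP hy]; last first.
  by rewrite (@cls_eq y x) // hy (eqP hx).
rewrite sumr_const -[X in X <= _]mulr_natr mulrC.
suff -> : #|[pred y | q y == c]|%:R = cls x by rewrite divff ?cls_neq0.
by rewrite /cls (eqP hx).
Qed.

Lemma fnorm_avg_le (A : 'M[R]_N) : fnorm (avg A) <= fnorm (A^T *m Emx).
Proof.
apply: le_trans (fnorm_Emxr _) _.
by rewrite -fnorm_tr trmx_mul Emx_sym.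
Qed.

Definition l1 (v : 'cV[R]_N) : R := \sum_x `|v x 0|.

Lemma l1_ge0 v : 0 <= l1 v.
Proof. exact: sumr_ge0. Qed.

Lemma l1_Emx v : l1 (Emx *m v) <= l1 v.
Proof.
apply: (@le_trans _ _ (\sum_x \sum_y Emx x y * `|v y 0|)).
  apply: ler_sum => x _; rewrite mxE; apply: le_trans (ler_norm_sum _ _ _) _.
  by apply: ler_sum => y _; rewrite normrM ger0_norm ?Emx_ge0.
rewrite exchange_big; apply: ler_sum => y _; rewrite -mulr_suml.
under eq_bigr => x _ do rewrite -Emx_sym mxE.
by rewrite Emx_row_sum mul1r.
Qed.

Lemma l1_le v : l1 v <= Num.sqrt N%:R * fnorm v.
Proof.
pose a : 'cV[R]_N := \col_x `|v x 0|.
have ha : fnorm a = fnorm v.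
  rewrite /fnorm; congr Num.sqrt; apply: eq_bigr => x _; rewrite !big_ord1 !mxE.
  by rewrite -!expr2 real_normK ?num_real.
have -> : l1 v = dotm (const_mx 1) a.
  by apply: eq_bigr => x _; rewrite big_ord1 !mxE mul1r.
apply: le_trans (dotm_le _ _) _; rewrite ha ler_wpM2r ?fnorm_ge0 //.
rewrite /fnorm ler_wsqrtr // /dotm.
under eq_bigr do rewrite big_ord1 !mxE mulr1.
by rewrite sumr_const card_ord.
Qed.

End OneColouring.

Definition refines (C C' : finType) (q' : 'I_N -> C') (q : 'I_N -> C) :=
  forall x y, q' x = q' y -> q x = q y.

Section Refinement.
Variables (C C' : finType) (q : 'I_N -> C) (q' : 'I_N -> C').
Hypothesis ref : refines q' q.

Lemma Emx_refl : Emx q' *m Emx q = Emx q.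
Proof. by apply: Emx_mul_const => x y j h; apply: Emx_const; apply: ref. Qed.

Lemma Emx_refr : Emx q *m Emx q' = Emx q.
Proof. by rewrite -[LHS]trmxK trmx_mul !Emx_sym Emx_refl Emx_sym. Qed.

Lemma avg_avg (A : 'M[R]_N) : avg q (avg q' A) = avg q A.
Proof. by rewrite /avg !mulmxA Emx_refr -!mulmxA Emx_refl. Qed.

Lemma avg_avg' (A : 'M[R]_N) : avg q' (avg q A) = avg q A.
Proof. by rewrite /avg !mulmxA Emx_refl -!mulmxA Emx_refr. Qed.

(** By [avg_avg], [avg q A] is the orthogonal projection of [avg q' A] onto the coarser block
    matrices. *)
Lemma pythagoras (A : 'M[R]_N) :
  fnorm (avg q' A - avg q A) ^+ 2 = fnorm (avg q' A) ^+ 2 - fnorm (avg q A) ^+ 2.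
Proof.
have h : dotm (avg q' A) (avg q A) = dotm (avg q A) (avg q A).
  by rewrite dotmC dotm_avg avg_avg [RHS]dotm_avg avg_idem.
by rewrite !fnorm2 dotmBl !dotmBr (dotmC (avg q A) (avg q' A)) h; ring.
Qed.

End Refinement.

(* In units of [sqrt N], [A] has bounded operator norm, and it maps vectors
   concentrated on few vertices to short ones. *)
Definition spread (kap : R) (A : 'M[R]_N) : Prop :=
  forall v : 'cV[R]_N, fnorm (A *m v) ^+ 2 <= kap * N%:R * fnorm v ^+ 2 + l1 v ^+ 2.

(** [Emx q] is symmetric and stochastic, so it contracts both the Euclidean norm and the l1 norm. *)
Lemma spread_avg kap (A : 'M[R]_N) (C : finType) (q : 'I_N -> C) :
  0 <= kap -> spread kap A -> spread kap (avg q A).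
Proof.
move=> k0 h v; rewrite /avg -!mulmxA.
apply: (@le_trans _ _ (fnorm (A *m (Emx q *m v)) ^+ 2)).
  by rewrite lerXn2r ?nnegrE ?fnorm_ge0 ?fnorm_Emxl.
apply: le_trans (h _) _; apply: lerD.
  rewrite ler_wpM2l ?mulr_ge0 ?ler0n // lerXn2r ?nnegrE ?fnorm_ge0 //.
  exact: fnorm_Emxl.
by rewrite lerXn2r ?nnegrE ?l1_ge0 ?l1_Emx.
Qed.

(** By Cauchy-Schwarz the square of [l1 v] is at most [N] times that of [fnorm v]. *)
Lemma spread_opb kap (A : 'M[R]_N) : 0 <= kap <= 1 -> spread kap A ->
  opb (2 * Num.sqrt N%:R) A.
Proof.
move=> /andP[k0 k1] h v; rewrite -(ler_pXn2r (n := 2)) ?nnegrE ?mulr_ge0 ?fnorm_ge0 ?sqrtr_ge0 //.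
apply: le_trans (h v) _; rewrite !exprMn (sqr_sqrtr (ler0n R N)).
have h1 : l1 v ^+ 2 <= N%:R * fnorm v ^+ 2.
  rewrite -[N%:R]sqr_sqrtr ?ler0n // -exprMn lerXn2r ?nnegrE ?l1_ge0 ?l1_le //.
  by rewrite mulr_ge0 ?fnorm_ge0 ?sqrtr_ge0.
have h2 : kap * N%:R * fnorm v ^+ 2 <= 1 * (N%:R * fnorm v ^+ 2).
  by rewrite -mulrA ler_wpM2r // mulr_ge0 ?sqr_ge0.
have h3 : 0 <= N%:R * fnorm v ^+ 2 by rewrite mulr_ge0 ?sqr_ge0.
by lra.
Qed.

(** Column [x] of [Emx q] has l1 norm 1 and squared length 1 / [cls q x], so [spread] bounds the
    squared length of its image by kap N / [cls q x] + 1; then [sum_inv_cls] sums over [x]. The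
    energy stays below 2N as long as kap times the number of classes is at most 1, and this bounds
    the number of energy increments. *)
Lemma energy_le kap (A : 'M[R]_N) (C : finType) (q : 'I_N -> C) :
  0 <= kap -> spread kap A^T -> fnorm (avg q A) ^+ 2 <= (kap * #|C|%:R + 1) * N%:R.
Proof.
move=> k0 h; apply: (@le_trans _ _ (fnorm (A^T *m Emx q) ^+ 2)).
  by rewrite lerXn2r ?nnegrE ?fnorm_ge0 ?fnorm_avg_le.
rewrite fnorm2 (dotm_col (A^T *m Emx q)).
apply: (@le_trans _ _ (\sum_x (kap * N%:R * (cls q x)^-1 + 1))).
  apply: ler_sum => x _; rewrite -fnorm2.
  have -> : col x (A^T *m Emx q) = A^T *m col x (Emx q) by rewrite !colE mulmxA.
  apply: le_trans (h _) _; apply: lerD.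
    rewrite ler_wpM2l ?mulr_ge0 ?ler0n // fnorm2 /dotm.
    under eq_bigr => y _ do rewrite big_ord1 !mxE.
    have -> : (cls q x)^-1 = \sum_y (q x == q y)%:R * (cls q x)^-1 ^+ 2.
      by rewrite -mulr_suml -clsE expr2 mulrA divff ?cls_neq0 ?mul1r.
    apply: ler_sum => y _; rewrite eq_sym; case: eqP => [e|_]; last by rewrite !mul0r.
    by rewrite (cls_eq e) !mul1r.
  suff -> : l1 (col x (Emx q)) = 1 by rewrite expr1n.
  rewrite -(Emx_row_sum q x); apply: eq_bigr => y _.
  by rewrite mxE ger0_norm ?Emx_ge0 // -[in LHS]Emx_sym mxE.
rewrite big_split /= -mulr_sumr sumr_const card_ord mulrDl mul1r lerD2r.
by rewrite -!mulrA ler_wpM2l // mulrC ler_wpM2r // sum_inv_cls.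
Qed.

End Averaging.

(** * Regularity partitions *)

Section Regularity.
Variable R : archiRcfType.

(** Testing the operator norm on vectors with boundedly many values suffices: [chi] records sign and
    rounded size of an entry. The error is small in l1 norm, which is what [spread] exploits. *)
Lemma round_vec N (L : nat) (v : 'cV[R]_N) : (0 < L)%N -> fnorm v <= 1 ->
  exists (chi : 'I_N -> bool * 'I_(L ^ 2).+1) (v' : 'cV[R]_N),
    [/\ forall x y, chi x = chi y -> v' x 0 = v' y 0,
        fnorm v' <= 1, fnorm (v - v') <= 1
      & l1 (v - v') <= 2 * Num.sqrt N%:R / L%:R].
Proof.
move=> L0 v1; set w := Num.sqrt N%:R.
pose t x := `|v x 0| * w.
(* Entries of size above L / w are replaced by 0, the others are rounded towards 0 to a multiple of
   1 / (L w). *)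
pose j x := if t x <= L%:R then Num.truncn (t x * L%:R) else 0%N.
pose a x : R := (j x)%:R / (L%:R * w).
have wpos (x : 'I_N) : 0 < w by rewrite sqrtr_gt0 ltr0n (leq_ltn_trans _ (ltn_ord x)).
have Lp : 0 < L%:R :> R by rewrite ltr0n.
have t0 x : 0 <= t x by rewrite mulr_ge0 ?sqrtr_ge0.
have jL x : (j x <= L ^ 2)%N.
  rewrite /j; case: ifP => // h; rewrite truncn_le_nat.
  apply: (@le_lt_trans _ _ (L ^ 2)%:R); last by rewrite ltr_nat.
  by rewrite natrX expr2 ler_wpM2r // ltW.
have jt x : (j x)%:R <= t x * L%:R.
  rewrite /j; case: ifP => _; last by rewrite mulr_ge0 ?ler0n.
  by rewrite truncn_le mulr_ge0 ?ler0n.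
have a0 x : 0 <= a x by rewrite divr_ge0 ?ler0n // mulr_ge0 ?sqrtr_ge0 ?ler0n.
have av x : a x <= `|v x 0|.
  rewrite ler_pdivrMr ?mulr_gt0 ?(wpos x) //.
  by apply: le_trans (jt x) _; rewrite /t mulrAC mulrA.
(* The first term pays for the rounding. The second pays for the entries cut to 0, where |v x| w >
   L. Each sums to at most w / L. *)
have dv x : `|v x 0| - a x <= w^-1 / L%:R + w / L%:R * (v x 0) ^+ 2.
  have wx := wpos x; have [h|h] := leP (t x) L%:R.
    have hj : t x * L%:R <= (j x)%:R + 1.
      by rewrite /j h natr1 ltW // truncnS_gt.
    have e : `|v x 0| = t x * L%:R / (L%:R * w).
      by rewrite /t; field; rewrite !gt_eqF.
    rewrite -[leLHS]addr0; apply: lerD; last first.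
      by rewrite mulr_ge0 ?sqr_ge0 // divr_ge0 ?ltW.
    rewrite e -mulrBl; have -> : w^-1 / L%:R = 1 / (L%:R * w) by field; rewrite !gt_eqF.
    apply: ler_wpM2r; first by rewrite invr_ge0 mulr_ge0 ?ltW.
    by rewrite lerBlDl.
  rewrite -[leLHS]add0r; apply: lerD; first by rewrite divr_ge0 ?invr_ge0 ?ltW.
  apply: (@le_trans _ _ `|v x 0|); first by rewrite gerBl.
  rewrite -[v x 0 ^+ 2]real_normK ?num_real //.
  have -> : w / L%:R * `|v x 0| ^+ 2 = `|v x 0| * (t x / L%:R) by rewrite /t; ring.
  by rewrite ler_peMr // ler_pdivlMr // mul1r ltW.
pose v' : 'cV[R]_N := \col_x ((-1) ^+ (v x 0 < 0)%R * a x).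
have vE x : v x 0 = (-1) ^+ (v x 0 < 0)%R * `|v x 0| by rewrite -realEsign ?num_real.
have vv x : (v - v') x 0 = (-1) ^+ (v x 0 < 0)%R * (`|v x 0| - a x).
  by rewrite !mxE {1}vE -mulrBr.
exists (fun x => ((v x 0 < 0)%R, inord (j x))), v'; split.
- move=> x y [h1 h2]; rewrite !mxE h1 /a; congr (_ * (_%:R / _)).
  by move/(congr1 val): h2; rewrite /= !inordK ?ltnS ?jL.
- apply: le_trans v1; rewrite -[leRHS](_ : fnorm (\col_x `|v x 0|) = _).
    apply: ler_fnorm => x i; rewrite ord1 !mxE normrM normrX normrN1 expr1n mul1r.
    by rewrite ger0_norm.
  rewrite /fnorm; congr Num.sqrt; apply: eq_bigr => x _; apply: eq_bigr => i _.
  by rewrite ord1 !mxE -!expr2 real_normK ?num_real.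
- apply: le_trans v1; rewrite -[leRHS](_ : fnorm (\col_x `|v x 0|) = _).
    apply: ler_fnorm => x i; rewrite ord1 vv mxE normrM normrX normrN1 expr1n mul1r.
    by rewrite ger0_norm ?subr_ge0 // gerBl.
  rewrite /fnorm; congr Num.sqrt; apply: eq_bigr => x _; apply: eq_bigr => i _.
  by rewrite ord1 !mxE -!expr2 real_normK ?num_real.
- apply: (@le_trans _ _ (\sum_x (w^-1 / L%:R + w / L%:R * (v x 0) ^+ 2))).
    apply: ler_sum => x _; rewrite vv normrM normrX normrN1 expr1n mul1r.
    by rewrite ger0_norm ?subr_ge0.
  rewrite big_split /= sumr_const card_ord -mulr_sumr -[X in X + _]mulr_natr.
  have -> : \sum_i v i 0 ^+ 2 = fnorm v ^+ 2.
    by rewrite fnorm2; apply: eq_bigr => x _; rewrite big_ord1.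
  have -> : 2 * w / L%:R = w / L%:R + w / L%:R * 1 by ring.
  apply: lerD.
    have -> : N%:R = w ^+ 2 by rewrite sqr_sqrtr ?ler0n.
    have [->|w0] := eqVneq w 0; first by rewrite invr0 !mul0r.
    by rewrite le_eqVlt; apply/orP; left; apply/eqP; field; rewrite w0 gt_eqF.
  rewrite ler_wpM2l ?divr_ge0 ?sqrtr_ge0 ?ler0n //.
  by rewrite expr_le1 ?fnorm_ge0.
Qed.

Section Fixed.
Variables (N : nat) (A : 'M[R]_N) (kap : R).
Hypotheses (N_gt0 : (0 < N)%N) (kap_ge0 : 0 <= kap).
Hypotheses (sA : spread kap A) (sAt : spread kap A^T).
Let w := Num.sqrt N%:R : R.

Let w2 : w ^+ 2 = N%:R.
Proof. by rewrite sqr_sqrtr ?ler0n. Qed.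

Let w_gt0 : 0 < w.
Proof. by rewrite sqrtr_gt0 ltr0n. Qed.

Lemma spread_flat (B : 'M[R]_N) (v : 'cV[R]_N) (a b : R) :
  0 <= a -> spread kap B -> fnorm v <= 1 -> l1 v <= b * w -> kap + b ^+ 2 <= a ^+ 2 ->
  fnorm (B *m v) <= a * w.
Proof.
move=> a0 sB v1 vb hab.
have aw0 : 0 <= a * w by rewrite mulr_ge0 ?sqrtr_ge0.
rewrite -(ler_pXn2r (n := 2)) ?nnegrE ?fnorm_ge0 //.
apply: le_trans (sB v) _; rewrite -w2 exprMn.
apply: (@le_trans _ _ ((kap + b ^+ 2) * w ^+ 2)); last by rewrite ler_wpM2r ?sqr_ge0.
rewrite mulrDl; apply: lerD.
  rewrite -[leRHS]mulr1; apply: ler_wpM2l; first by rewrite mulr_ge0 1?sqr_ge0.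
  by rewrite exprn_ile1 ?fnorm_ge0.
by rewrite -exprMn lerXn2r ?nnegrE ?l1_ge0 // (le_trans _ vb) ?l1_ge0.
Qed.

Lemma spread_diff_flat (B : 'M[R]_N) (C : finType) (q : 'I_N -> C)
    (v : 'cV[R]_N) (a b : R) :
  0 <= a -> spread kap B -> fnorm v <= 1 -> l1 v <= b * w -> kap + b ^+ 2 <= a ^+ 2 ->
  fnorm ((B - avg q B) *m v) <= 2 * a * w.
Proof.
move=> a0 sB v1 vb hab; rewrite mulmxBl; apply: le_trans (fnormB _ _) _.
have -> : 2 * a * w = a * w + a * w by ring.
by apply: lerD; apply: spread_flat hab => //; apply: spread_avg.
Qed.

(** The number of joint values of the labels [chi] of two rounded vectors. *)
Definition refine_factor (L : nat) : nat := ((2 * (L ^ 2).+1) ^ 2)%N.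

(** Unit vectors [u], [v] witness the large operator norm of [D]. They are rounded to [u'], [v'],
    and [q] is refined by their level sets. Each rounding costs at most g w / 4, so <u', D v'> is
    still at least g w / 2. This bounds the Frobenius norm of [avg q' A - avg q A] from below, and
    [pythagoras] turns it into energy. *)
Lemma energy_increment (g : R) (L : nat) (C : finType) (q : 'I_N -> C) :
  0 < g -> (0 < L)%N -> kap + (2 / L%:R) ^+ 2 <= (g / 8) ^+ 2 ->
  ~ opb (g * w) (A - avg q A) ->
  exists (C' : finType) (q' : 'I_N -> C'),
    [/\ refines q' q, (#|C'| <= #|C| * refine_factor L)%N
      & fnorm (avg q A) ^+ 2 + g ^+ 2 / 4 * N%:R <= fnorm (avg q' A) ^+ 2].
Proof.
move=> g0 L0 hkap /existsNP [v0 /negP]; rewrite -ltNge => hv0.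
set D := A - avg q A in hv0 *.
have v0p : 0 < fnorm v0.
  rewrite lt_def fnorm_ge0 andbT; apply/negP => /eqP /fnorm_eq0 e.
  by rewrite e mulmx0 !fnorm0 mulr0 ltxx in hv0.
pose v : 'cV[R]_N := (fnorm v0)^-1 *: v0.
have v1 : fnorm v = 1 by rewrite fnormZ gtr0_norm ?invr_gt0 // mulVf ?gt_eqF.
have hv : g * w < fnorm (D *m v).
  by rewrite -scalemxAr fnormZ gtr0_norm ?invr_gt0 // [ltRHS]mulrC ltr_pdivlMr.
have Dvp : 0 < fnorm (D *m v) by apply: lt_trans hv; rewrite mulr_gt0.
pose u : 'cV[R]_N := (fnorm (D *m v))^-1 *: (D *m v).
have u1 : fnorm u = 1 by rewrite fnormZ gtr0_norm ?invr_gt0 // mulVf ?gt_eqF.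
have huv : g * w < dotm u (D *m v).
  by rewrite dotmZl -fnorm2 expr2 mulrA mulVf ?gt_eqF // mul1r.
have eqW (x : R) : x = 1 -> x <= 1 by move=> ->.
have [chi [v' [cv v'1 dv lv]]] := round_vec L0 (eqW _ v1).
have [psi [u' [cu u'1 du lu]]] := round_vec L0 (eqW _ u1).
pose q' x := (q x, chi x, psi x).
have ref : refines q' q by move=> x y [].
exists (C * (bool * 'I_(L ^ 2).+1) * (bool * 'I_(L ^ 2).+1))%type, q'; split => //.
  by rewrite !card_prod card_bool card_ord /refine_factor -(mulnn (2 * _)) !mulnA.
have Ev : Emx R q' *m v' = v'.
  by apply: Emx_mul_const => x y i [_ h _]; rewrite !ord1; apply: cv.
have Eu : Emx R q' *m u' = u'.
  by apply: Emx_mul_const => x y i [_ _ h]; rewrite !ord1; apply: cu.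
have g80 : 0 <= g / 8 by rewrite divr_ge0 ?ltW.
have g4 : g / 4 = 2 * (g / 8) by field.
have e1 : fnorm (D *m (v - v')) <= g / 4 * w.
  rewrite mulrAC in lv; rewrite g4.
  exact: (spread_diff_flat q g80 sA dv lv hkap).
have e2 : fnorm (D^T *m (u - u')) <= g / 4 * w.
  rewrite mulrAC in lu; rewrite g4 /D [(_ - _)^T]linearB /= avg_tr.
  exact: (spread_diff_flat q g80 sAt du lu hkap).
have h1 : dotm u (D *m v) = dotm (D^T *m (u - u')) v + dotm u' (D *m (v - v')) + dotm u' (D *m v').
  by rewrite dotm_mull trmxK dotmBl mulmxBr dotmBr; ring.
have h2 : dotm (D^T *m (u - u')) v <= g / 4 * w.
  by apply: le_trans (dotm_le _ _) _; rewrite v1 mulr1.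
have h3 : dotm u' (D *m (v - v')) <= g / 4 * w.
  apply: le_trans (dotm_le _ _) _; apply: le_trans e1.
  by rewrite -[leRHS]mul1r ler_wpM2r ?fnorm_ge0.
(* Since [u'] and [v'] are constant on the classes of [q'], [D] may be averaged over [q']. *)
have h4 : dotm u' (D *m v') <= fnorm (avg q' A - avg q A).
  have -> : dotm u' (D *m v') = dotm u' ((avg q' A - avg q A) *m v').
    rewrite -{1}Ev -{1}Eu dotm_mull Emx_sym !mulmxA.
    by rewrite -[avg q A](avg_avg' ref) /D /avg mulmxBr mulmxBl.
  apply: le_trans (dotm_le _ _) _.
  apply: (@le_trans _ _ (1 * fnorm ((avg q' A - avg q A) *m v'))).
    by rewrite ler_wpM2r ?fnorm_ge0.
  rewrite mul1r; apply: le_trans (fnorm_mul _ _) _.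
  by rewrite -[leRHS]mulr1 ler_wpM2l ?fnorm_ge0.
have h5 : g / 2 * w <= fnorm (avg q' A - avg q A).
  have e : g * w = g / 4 * w + g / 4 * w + g / 2 * w by field.
  rewrite -(lerD2l (g / 4 * w + g / 4 * w)) -e ltW //.
  by apply: lt_le_trans huv _; rewrite h1 !lerD.
rewrite -lerBrDl -(pythagoras ref).
have -> : g ^+ 2 / 4 * N%:R = (g / 2 * w) ^+ 2 by rewrite exprMn w2; field.
by rewrite lerXn2r ?nnegrE ?fnorm_ge0 // mulr_ge0 ?divr_ge0 ?ltW.
Qed.

(** [energy_increment] is repeated until the operator norm is small, or [T] times. *)
Lemma weak_iter (g : R) (L : nat) (T : nat) (C : finType) (q : 'I_N -> C) :
  0 < g -> (0 < L)%N -> kap + (2 / L%:R) ^+ 2 <= (g / 8) ^+ 2 ->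
  exists (C' : finType) (q' : 'I_N -> C'),
    [/\ refines q' q, (#|C'| <= #|C| * refine_factor L ^ T)%N
      & opb (g * w) (A - avg q' A) \/
        fnorm (avg q A) ^+ 2 + T%:R * (g ^+ 2 / 4 * N%:R) <= fnorm (avg q' A) ^+ 2].
Proof.
move=> g0 L0 hkap; elim: T => [|T [C1 [q1 [r1 c1 h1]]]].
  by exists C, q; split; [|rewrite muln1|right; rewrite mul0r addr0].
have c1' : (#|C1| <= #|C| * refine_factor L ^ T.+1)%N.
  by apply: leq_trans c1 _; rewrite leq_mul2l leq_pexp2l ?orbT // expn_gt0.
have [ho|hno] := EM (opb (g * w) (A - avg q1 A)).
  by exists C1, q1; split => //; left.
case: h1 => // h1.
have [C2 [q2 [r2 c2 h2]]] := energy_increment g0 L0 hkap hno.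
exists C2, q2; split.
- by move=> x y /r2 /r1.
- by apply: leq_trans c2 _; rewrite expnSr mulnA leq_mul2r c1 orbT.
- right; apply: le_trans h2; rewrite -natr1 mulrDl mul1r addrA.
  by rewrite lerD2r.
Qed.

End Fixed.

Lemma ex_nat_gt (x : R) : exists n : nat, x < n%:R.
Proof. by exists (Num.truncn x).+1; rewrite truncnS_gt. Qed.

(** More than 8 / g^2 increments of g^2 N / 4 would exceed the energy bound 2N. In the hypothesis of
    [energy_increment], the budget (g / 8)^2 is shared equally between kap and (2 / L)^2, whence g^2
    / 128 and L > 32 / g. *)
Lemma weak_regularity (g : R) (m : nat) : 0 < g ->
  exists (M : nat) (kap0 : R), 0 < kap0 /\
  forall (N : nat) (A : 'M[R]_N) (kap : R), (0 < N)%N -> 0 <= kap <= kap0 ->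
  spread kap A -> spread kap A^T ->
  forall (C : finType) (q : 'I_N -> C), (#|C| <= m)%N ->
  exists (C' : finType) (q' : 'I_N -> C'),
    [/\ refines q' q, (#|C'| <= M)%N & opb (g * Num.sqrt N%:R) (A - avg q' A)].
Proof.
move=> g0.
have [L hL] := ex_nat_gt (32 / g).
have Lp : 0 < L%:R :> R by apply: lt_trans hL; rewrite divr_gt0.
have L0 : (0 < L)%N by rewrite ltr0n in Lp.
have [T hT] := ex_nat_gt (8 / g ^+ 2).
pose M := (m * refine_factor L ^ T)%N.
have M1 : 0 < M%:R + 1 :> R by rewrite ltr_wpDl ?ler0n.
exists M, (Num.min (g ^+ 2 / 128) (M%:R + 1)^-1); split.
  by rewrite lt_min invr_gt0 M1 divr_gt0 ?exprn_gt0.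
move=> N A kap N0 /andP[k0]; rewrite le_min => /andP[k1 k2] sA sAt C q Cm.
have hkap : kap + (2 / L%:R) ^+ 2 <= (g / 8) ^+ 2.
  have h : 2 / L%:R <= g / 16.
    rewrite ler_pdivrMr // mulrAC ler_pdivlMr // [leRHS]mulrC -ler_pdivrMr //.
    by apply: ltW; rewrite (_ : 2 * 16 = 32) // -natrM.
  have h2 : (2 / L%:R) ^+ 2 <= (g / 16) ^+ 2.
    by apply: lerXn2r; rewrite // nnegrE divr_ge0 // ltW.
  have e : (g / 8) ^+ 2 = g ^+ 2 / 128 + 2 * (g / 16) ^+ 2 by field.
  rewrite e; apply: lerD => //; apply: le_trans h2 _.
  by rewrite ler_peMl ?sqr_ge0 ?ler1n.
have [C1 [q1 [r1 c1 [h1|h1]]]] := weak_iter N0 k0 sA sAt T q g0 L0 hkap.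
  by exists C1, q1; split => //; apply: leq_trans c1 _; rewrite leq_mul2r Cm orbT.
exfalso.
have c1M : (#|C1| <= M)%N by apply: leq_trans c1 _; rewrite leq_mul2r Cm orbT.
have Np : 0 < N%:R :> R by rewrite ltr0n.
have := le_trans h1 (energy_le q1 k0 sAt); apply/negP; rewrite -ltNge.
apply: (@le_lt_trans _ _ (2 * N%:R)).
  rewrite ler_wpM2r ?ler0n // [leRHS](_ : 2 = 1 + 1) // lerD2r.
  apply: (@le_trans _ _ ((M%:R + 1)^-1 * M%:R)).
    by rewrite ler_pM ?ler0n ?ler_nat.
  by rewrite mulrC ler_pdivrMr // mul1r lerDl.
apply: (@lt_le_trans _ _ (T%:R * (g ^+ 2 / 4 * N%:R))); last by rewrite lerDr sqr_ge0.
rewrite mulrA ltr_pM2r // mulrA ltr_pdivlMr //.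
have -> : 2 * 4 = 8 :> R by rewrite -natrM.
by rewrite -ltr_pdivrMr ?exprn_gt0.
Qed.

(** One round refines [q], with at most [m] classes, to operator norm error [gam m]. Either this
    changes the average by little, and the pair ([q], refinement) is the desired one, or the energy
    grows by more than zeta N and the next round starts from the refinement. The bound [m'] rather
    than the class count itself is fed to [gam]. *)
Lemma strong_iter (gam : nat -> R) (zeta : R) : (forall m, 0 < gam m) ->
  forall J m : nat, exists (M : nat) (kap0 : R), 0 < kap0 /\
  forall (N : nat) (A : 'M[R]_N) (kap : R), (0 < N)%N -> 0 <= kap <= kap0 ->
  spread kap A -> spread kap A^T ->
  forall (C : finType) (q : 'I_N -> C), (#|C| <= m)%N ->
  (exists (m' : nat) (C1 C2 : finType) (q1 : 'I_N -> C1) (q2 : 'I_N -> C2),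
    [/\ refines q2 q1, (#|C1| <= m')%N, (m' <= M)%N,
        opb (gam m' * Num.sqrt N%:R) (A - avg q2 A)
      & fnorm (avg q2 A - avg q1 A) ^+ 2 <= zeta * N%:R]) \/
  (exists (C1 : finType) (q1 : 'I_N -> C1), (#|C1| <= M)%N /\
     fnorm (avg q A) ^+ 2 + J%:R * (zeta * N%:R) <= fnorm (avg q1 A) ^+ 2).
Proof.
move=> gam0; elim=> [|J IH] m.
  exists m, 1; split => // N A kap _ _ _ _ C q Cm; right.
  by exists C, q; rewrite mul0r addr0.
have [M1 [k1 [k1p h1]]] := weak_regularity m (gam0 m).
have [M2 [k2 [k2p h2]]] := IH M1.
exists (maxn m M2), (Num.min k1 k2); split; first by rewrite lt_min k1p.
move=> N A kap N0 /andP[k0]; rewrite le_min => /andP[kk1 kk2] sA sAt C q Cm.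
have [|C' [q' [r' c' o']]] := h1 N A kap N0 _ sA sAt C q Cm; first by rewrite k0.
have [hz|hz] := leP (fnorm (avg q' A - avg q A) ^+ 2) (zeta * N%:R).
  by left; exists m, C, C', q, q'; split; rewrite ?leq_maxl.
have [|[m' [C1 [C2 [q1 [q2 [a b c d e]]]]]]|[C1 [q1 [a b]]]] :=
    h2 N A kap N0 _ sA sAt C' q' c'; first by rewrite k0.
  by left; exists m', C1, C2, q1, q2; split => //; apply: leq_trans c (leq_maxr _ _).
right; exists C1, q1; split; first by apply: leq_trans a (leq_maxr _ _).
apply: le_trans b; rewrite -natr1 mulrDl mul1r addrA addrAC lerD2r.
by move: hz; rewrite (pythagoras r') ltrBrDl => /ltW; rewrite addrC.
Qed.

(** Starting from the trivial partition, J > 2 / zeta rounds without success would exceed the energy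
    bound 2N. *)
Lemma strong_regularity (gam : nat -> R) (zeta : R) :
  (forall m, 0 < gam m) -> 0 < zeta ->
  exists (M : nat) (kap0 : R), 0 < kap0 /\
  forall (N : nat) (A : 'M[R]_N) (kap : R), (0 < N)%N -> 0 <= kap <= kap0 ->
  spread kap A -> spread kap A^T ->
  exists (m : nat) (C1 C2 : finType) (q1 : 'I_N -> C1) (q2 : 'I_N -> C2),
    [/\ refines q2 q1, (#|C1| <= m)%N, (m <= M)%N,
        opb (gam m * Num.sqrt N%:R) (A - avg q2 A)
      & fnorm (avg q2 A - avg q1 A) ^+ 2 <= zeta * N%:R].
Proof.
move=> gam0 z0; have [J hJ] := ex_nat_gt (2 / zeta).
have [M [k0 [k0p h]]] := strong_iter zeta gam0 J 1.
have M1 : 0 < M%:R + 1 :> R by rewrite ltr_wpDl ?ler0n.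
exists M, (Num.min k0 (M%:R + 1)^-1); split; first by rewrite lt_min k0p invr_gt0.
move=> N A kap N0 /andP[ka]; rewrite le_min => /andP[kk1 kk2] sA sAt.
have [||//|[C1 [q1 [a b]]]] := h N A kap N0 _ sA sAt unit (fun=> tt); rewrite ?card_unit ?ka //.
exfalso.
have Np : 0 < N%:R :> R by rewrite ltr0n.
have := le_trans b (energy_le q1 ka sAt); apply/negP; rewrite -ltNge.
apply: (@le_lt_trans _ _ (2 * N%:R)).
  rewrite ler_wpM2r ?ler0n // [leRHS](_ : 2 = 1 + 1) // lerD2r.
  apply: (@le_trans _ _ ((M%:R + 1)^-1 * M%:R)).
    by rewrite ler_pM ?ler0n ?ler_nat.
  by rewrite mulrC ler_pdivrMr // mul1r lerDl.
apply: (@lt_le_trans _ _ (J%:R * (zeta * N%:R))); last by rewrite lerDr sqr_ge0.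
by rewrite mulrA ltr_pM2r // -ltr_pdivrMr.
Qed.

End Regularity.

(** * Traces of products along a cycle *)

Section Telescoping.
Variables (R : rcfType) (N : nat).
Implicit Types (M P D : 'M[R]_N) (F G J : nat -> 'M[R]_N).

Section Operator.
Variables (g h C : R).
Hypotheses (g_ge0 : 0 <= g) (h_ge0 : 0 <= h).

(** The second condition says that the squared Schatten 4-norm of [M] is at most [C]. *)
Definition nice M : Prop := opb h M /\ fnorm (M^T *m M) <= C.

Lemma opb_prod (s : seq 'M[R]_N) :
  {in s, forall M, opb h M} -> opb (h ^+ size s) (\prod_(M <- s) M).
Proof.
elim: s => [|M s IH] hs.
  by move=> v; rewrite big_nil mul1mx expr0 mul1r.
rewrite big_cons exprS; apply: opb_comp => //.
  by apply: hs; rewrite inE eqxx.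
by apply: IH => P Ps; apply: hs; rewrite inE Ps orbT.
Qed.

(** Hölder's inequality: the product is cut into [D M1 M2] and [M3 M4 P], and the trace is at most
    the product of the two Frobenius norms. [fnorm_mul_gram] bounds [M1 M2] and [M3 M4]; [D] and [P]
    enter through their operator norms. *)
Lemma trace_prod_le D (s : seq 'M[R]_N) : (4 <= size s)%N ->
  opb g D -> {in s, forall M, nice M} ->
  `|\tr (D * \prod_(M <- s) M)| <= g * C ^+ 2 * h ^+ (size s - 4).
Proof.
case: s => [//|M1 [//|M2 [//|M3 [//|M4 s]]]] _ hD hs.
have n1 : nice M1 by apply: hs; rewrite !inE eqxx.
have n2 : nice M2 by apply: hs; rewrite !inE eqxx orbT.
have n3 : nice M3 by apply: hs; rewrite !inE eqxx !orbT.
have n4 : nice M4 by apply: hs; rewrite !inE eqxx !orbT.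
have hP : opb (h ^+ size s) (\prod_(M <- s) M).
  by apply: opb_prod => M Ms; have [] : nice M by apply: hs; rewrite !inE Ms !orbT.
rewrite !big_cons -!mulmxE; set P := \prod_(M <- s) M in hP *.
have -> : D *m (M1 *m (M2 *m (M3 *m (M4 *m P)))) = (D *m (M1 *m M2)) *m ((M3 *m M4) *m P).
  by rewrite !mulmxA.
apply: le_trans (mxtrace_mul_le _ _) _.
have -> : g * C ^+ 2 * h ^+ (size [:: M1, M2, M3, M4 & s] - 4) =
    (g * C) * (h ^+ size s * C) by rewrite /= subSS subSS subSS subSS subn0; ring.
apply: ler_pM; rewrite ?fnorm_ge0 //.
  apply: le_trans (opb_mull _ g_ge0 hD) _; apply: ler_wpM2l => //.
  by apply: fnorm_mul_gram; [case: n1|case: n2].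
apply: le_trans (opb_mulr _ _ hP) _; first by rewrite exprn_ge0.
apply: ler_wpM2l; first by rewrite exprn_ge0.
by apply: fnorm_mul_gram; [case: n3|case: n4].
Qed.

(** [s] holds the factors already replaced. Cyclicity of the trace brings the difference [F i - G i]
    to the front, and a total length of at least 5 leaves the four factors that [trace_prod_le] asks
    for. *)
Lemma trace_telescope F G (s : seq 'M[R]_N) (l : seq nat) :
  (5 <= size s + size l)%N ->
  (forall i, nice (F i)) -> (forall i, nice (G i)) ->
  (forall i, opb g (F i - G i)) -> {in s, forall M, nice M} ->
  `|\tr (\prod_(M <- s) M * \prod_(i <- l) F i) - \tr (\prod_(M <- s) M * \prod_(i <- l) G i)|
  <= (size l)%:R * (g * C ^+ 2 * h ^+ (size s + size l - 5)).
Proof.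
move=> + nF nG nD; elim: l s => [|i l IH] s hs ns.
  by rewrite !big_nil subrr normr0 mul0r.
rewrite !big_cons; set P := \prod_(M <- s) M; set Fs := \prod_(j <- l) F j.
set Gs := \prod_(j <- l) G j.
have -> : \tr (P * (F i * Fs)) - \tr (P * (G i * Gs)) =
    \tr ((F i - G i) * (Fs * P)) + (\tr (P * G i * Fs) - \tr (P * G i * Gs)).
  have -> : \tr ((F i - G i) * (Fs * P)) = \tr (P * ((F i - G i) * Fs)).
    by rewrite -!mulmxE mulmxA mxtrace_mulC.
  by rewrite mulrBl mulrBr linearB /= !mulrA; ring.
rewrite /= -natr1 [leRHS]mulrDl [1 * _]mul1r [leRHS]addrC.
apply: le_trans (ler_normD _ _) _; apply: lerD; last first.
  have := IH (rcons s (G i)); rewrite !big_rcons /= size_rcons addSnnS; apply => //.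
  by move=> M; rewrite mem_rcons inE => /orP[/eqP->|/ns].
have := @trace_prod_le (F i - G i) (map F l ++ s).
rewrite big_cat /= big_map size_cat size_map -/P -/Fs [(size l + _)%N]addnC addnS subSS.
rewrite addnS ltnS in hs.
apply => // M; rewrite mem_cat => /orP[/mapP[j _ ->] //|/ns //].
Qed.

End Operator.

(** The two bounds go through one induction, as the difference of the products needs the norm of the
    product of the [G j]. The list is nonempty because the empty product is the identity, whose
    Frobenius norm is sqrt N. *)
Lemma fnorm_prod_telescope G J (W : nat -> R) (tau : R) (i : nat) (l : seq nat) :
  0 <= tau -> (forall i, fnorm (J i) <= W i) ->
  (forall i, fnorm (G i - J i) <= tau * W i) ->
  fnorm (\prod_(j <- i :: l) G j - \prod_(j <- i :: l) J j)
    <= ((1 + tau) ^+ (size l).+1 - 1) * \prod_(j <- i :: l) W j /\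
  fnorm (\prod_(j <- i :: l) G j) <= (1 + tau) ^+ (size l).+1 * \prod_(j <- i :: l) W j.
Proof.
move=> tau0 hJ hGJ.
have W0 j : 0 <= W j by apply: le_trans (fnorm_ge0 _) (hJ j).
have hG j : fnorm (G j) <= (1 + tau) * W j.
  have -> : G j = J j + (G j - J j) by rewrite addrC subrK.
  by rewrite mulrDl mul1r; apply: le_trans (fnormD _ _) _; apply: lerD.
elim: l i => [|i' l IH] i; first by rewrite /= !big_seq1 expr1 [1 + tau - 1]addrAC subrr add0r.
have bcM (X : nat -> 'M[R]_N) : \prod_(j <- [:: i, i' & l]) X j = X i * \prod_(j <- i' :: l) X j.
  by rewrite big_cons.
have bcR (X : nat -> R) : \prod_(j <- [:: i, i' & l]) X j = X i * \prod_(j <- i' :: l) X j.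
  by rewrite big_cons.
have [IH1 IH2] := IH i'; rewrite !bcM !bcR.
move: IH1 IH2; set PG := \prod_(j <- _) G j; set PJ := \prod_(j <- _) J j.
set PW := \prod_(j <- _) W j; set a := (1 + tau) ^+ _ => IH1 IH2.
have -> : (1 + tau) ^+ (size (i' :: l)).+1 = (1 + tau) * a by rewrite -exprS.
split.
  have -> : G i * PG - J i * PJ = (G i - J i) * PG + J i * (PG - PJ).
    by rewrite mulrBl mulrBr addrA subrK.
  have -> : ((1 + tau) * a - 1) * (W i * PW) =
    (tau * W i) * (a * PW) + W i * ((a - 1) * PW) by ring.
  apply: le_trans (fnormD _ _) _; apply: lerD.
    by apply: le_trans (fnorm_mul _ _) _; rewrite ler_pM ?fnorm_ge0.
  by apply: le_trans (fnorm_mul _ _) _; rewrite ler_pM ?fnorm_ge0.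
have -> : (1 + tau) * a * (W i * PW) = ((1 + tau) * W i) * (a * PW) by ring.
by apply: le_trans (fnorm_mul _ _) _; rewrite ler_pM ?fnorm_ge0.
Qed.

(** The trace is controlled by a product of two Frobenius norms, so the first factor is split off
    and a second one must remain. *)
Lemma trace_telescope_fnorm G J (W : nat -> R) (tau : R) (i : nat) (l : seq nat) :
  l != [::] -> 0 <= tau -> (forall i, fnorm (J i) <= W i) ->
  (forall i, fnorm (G i - J i) <= tau * W i) ->
  `|\tr (\prod_(j <- i :: l) G j) - \tr (\prod_(j <- i :: l) J j)|
    <= ((1 + tau) ^+ (size l).+1 - 1) * \prod_(j <- i :: l) W j.
Proof.
case: l => [//|i' l] _ tau0 hJ hGJ.
have W0 j : 0 <= W j by apply: le_trans (fnorm_ge0 _) (hJ j).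
have [IH1 IH2] := fnorm_prod_telescope i' l tau0 hJ hGJ.
have bcM (X : nat -> 'M[R]_N) : \prod_(j <- [:: i, i' & l]) X j = X i * \prod_(j <- i' :: l) X j.
  by rewrite big_cons.
have bcR (X : nat -> R) : \prod_(j <- [:: i, i' & l]) X j = X i * \prod_(j <- i' :: l) X j.
  by rewrite big_cons.
rewrite !bcM !bcR.
move: IH1 IH2; set PG := \prod_(j <- _) G j; set PJ := \prod_(j <- _) J j.
set PW := \prod_(j <- _) W j; set a := (1 + tau) ^+ _ => IH1 IH2.
have -> : (1 + tau) ^+ (size (i' :: l)).+1 = (1 + tau) * a by rewrite -exprS.
have -> : \tr (G i * PG) - \tr (J i * PJ) = \tr ((G i - J i) * PG) + \tr (J i * (PG - PJ)).
  by rewrite -!linearB /= -linearD /= mulrBl mulrBr addrA subrK.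
have -> : ((1 + tau) * a - 1) * (W i * PW) =
  (tau * W i) * (a * PW) + W i * ((a - 1) * PW) by ring.
apply: le_trans (ler_normD _ _) _; apply: lerD.
  by apply: le_trans (mxtrace_mul_le _ _) _; rewrite ler_pM ?fnorm_ge0.
by apply: le_trans (mxtrace_mul_le _ _) _; rewrite ler_pM ?fnorm_ge0.
Qed.

Lemma prod_mx_le F (A : 'M[R]_N) (l : seq nat) :
  (forall i x y, 0 <= F i x y <= A x y) ->
  forall x y, 0 <= (\prod_(i <- l) F i) x y <= (A ^+ size l) x y.
Proof.
move=> h; elim: l => [|i l IH] x y.
  by rewrite big_nil expr0 lexx andbT mxE; case: eqP.
rewrite big_cons exprS -!mulmxE !mxE; apply/andP; split.
  apply: sumr_ge0 => z _; have /andP[h1 _] := h i x z; have /andP[h2 _] := IH z y.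
  exact: mulr_ge0.
apply: ler_sum => z _; have /andP[h1 h1'] := h i x z; have /andP[h2 h2'] := IH z y.
exact: ler_pM.
Qed.

Lemma prod_rank1 (u : nat -> 'cV[R]_N) (d : nat -> R) (k : nat) :
  \prod_(i <- iota 0 k.+1) (d i *: (u i *m (u i.+1)^T)) =
  ((\prod_(i <- iota 0 k.+1) d i) * \prod_(i <- iota 1 k) dotm (u i) (u i)) *:
     (u 0%N *m (u k.+1)^T).
Proof.
elim: k => [|k IH]; first by rewrite /= !big_seq1 big_nil mulr1.
have e : iota 0 k.+2 = rcons (iota 0 k.+1) k.+1 by rewrite -cats1 -[in LHS](addn1 k.+1) iotaD.
have e' : iota 1 k.+1 = rcons (iota 1 k) k.+1 by rewrite -cats1 -[in LHS](addn1 k) iotaD.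
rewrite e e' !big_rcons IH /=.
rewrite -mulmxE -scalemxAl -scalemxAr scalerA.
have -> : u 0%N *m (u k.+1)^T *m (u k.+1 *m (u k.+2)^T) =
    dotm (u k.+1) (u k.+1) *: (u 0%N *m (u k.+2)^T).
  rewrite mulmxA -[u 0%N *m _ *m _]mulmxA.
  have -> : (u k.+1)^T *m u k.+1 = (dotm (u k.+1) (u k.+1))%:M.
    apply/matrixP => i j; rewrite !ord1 dotmE [in RHS]mxE eqxx mulr1n.
    by rewrite /mxtrace big_ord1.
  by rewrite mul_mx_scalar scalemxAl.
by rewrite scalerA; congr (_ *: _); ring.
Qed.

End Telescoping.

(** * Restriction of a matrix to a pair of classes *)

Section Restriction.
Variables (R : rcfType) (N : nat) (C : finType) (q : 'I_N -> C).
Implicit Types M P : 'M[R]_N.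

Definition ind (x : 'I_N) : 'cV[R]_N := \col_i (q x == q i)%:R.

Definition res (x y : 'I_N) M : 'M[R]_N :=
  \matrix_(i, j) ((q x == q i)%:R * M i j * (q y == q j)%:R).

Lemma resB x y M P : res x y (M - P) = res x y M - res x y P.
Proof. by apply/matrixP => i j; rewrite !mxE; ring. Qed.

Lemma res_bounds x y M i j : (forall i j, 0 <= M i j) -> 0 <= res x y M i j <= M i j.
Proof.
by move=> h; rewrite mxE; do 2!case: eqP => _; rewrite ?(mul0r, mulr0, mul1r, mulr1) lexx h.
Qed.

Lemma fnorm_res x y M : fnorm (res x y M) <= fnorm M.
Proof.
rewrite -[leRHS](_ : fnorm (map_mx (fun a => `|a|) M) = _).
  apply: ler_fnorm => i j; rewrite !mxE !normrM.
  by do 2!case: eqP => _; rewrite /= ?(normr0, normr1, mul0r, mulr0, mul1r, mulr1).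
rewrite /fnorm; congr Num.sqrt; apply: eq_bigr => i _; apply: eq_bigr => j _.
by rewrite mxE -!expr2 real_normK ?num_real.
Qed.

Lemma opb_res x y M (g : R) : 0 <= g -> opb g M -> opb g (res x y M).
Proof.
move=> g0 h v.
pose v' : 'cV[R]_N := \col_j ((q y == q j)%:R * v j 0).
have -> : res x y M *m v = \col_i ((q x == q i)%:R * (M *m v') i 0).
  apply/matrixP => i j; rewrite !mxE mulr_sumr ord1; apply: eq_bigr => l _.
  by rewrite !mxE !mulrA.
have red (z : 'I_N) (u : 'cV[R]_N) : fnorm (\col_i ((q z == q i)%:R * u i 0)) <= fnorm u.
  apply: fnorm_le; rewrite ?fnorm_ge0 // fnorm2; apply: ler_sum => i _.
  rewrite !big_ord1 mxE; case: eqP => _; rewrite ?mul1r ?mul0r //.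
  by rewrite -expr2 sqr_ge0.
apply: le_trans (red _ _) _; apply: le_trans (h _) _.
by apply: ler_wpM2l => //; apply: red.
Qed.

(** For nonnegative entries, setting some to 0 decreases the Gram matrix entrywise. *)
Lemma gram_res x y M : (forall i j, 0 <= M i j) ->
  fnorm ((res x y M)^T *m res x y M) <= fnorm (M^T *m M).
Proof.
move=> h; apply: ler_fnorm => i j; rewrite !mxE.
have b l p : 0 <= res x y M l p <= M l p by apply: res_bounds.
rewrite ger0_norm; last first.
  apply: sumr_ge0 => l _; rewrite [(res _ _ _)^T _ _]mxE.
  by have /andP[b1 _] := b l i; have /andP[b2 _] := b l j; rewrite mulr_ge0.
apply: ler_sum => l _; rewrite [(res _ _ _)^T _ _]mxE [M^T _ _]mxE.
have /andP[b1 b1'] := b l i; have /andP[b2 b2'] := b l j; exact: ler_pM.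
Qed.

Lemma dotm_ind x : dotm (ind x) (ind x) = cls R q x.
Proof.
rewrite clsE; apply: eq_bigr => i _; rewrite big_ord1 !mxE.
by case: eqP; rewrite ?mulr1 ?mulr0.
Qed.

Lemma res_const x y M : (forall i j, q x = q i -> q y = q j -> M i j = M x y) ->
  res x y M = M x y *: (ind x *m (ind y)^T).
Proof.
move=> h; apply/matrixP => i j; rewrite !mxE big_ord1 !mxE.
case: eqP => [e1|_]; last by rewrite !mul0r mulr0.
by case: eqP => [e2|_]; rewrite ?mulr0 // h // !mul1r.
Qed.

Lemma fnorm2_res x y M :
  fnorm (res x y M) ^+ 2 = avg q (map_mx (fun a => a ^+ 2) M) x y * (cls R q x * cls R q y).
Proof.
rewrite avgE fnorm2 [RHS]big_mkcond; apply: eq_bigr => i _.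
case: eqP => [e1|h1]; last first.
  by rewrite big1 // => j _; rewrite !mxE; case: eqP => // _; rewrite !mul0r.
rewrite [RHS]big_mkcond; apply: eq_bigr => j _; rewrite !mxE e1 eqxx mul1r.
by case: eqP => _; rewrite ?mulr0 ?mul0r // mulr1 expr2.
Qed.

End Restriction.

(** * The removal lemma *)

Section Cleaning.
Variables (R : rcfType) (N : nat) (C : finType) (q : 'I_N -> C).
Variables (A B : 'M[R]_N).

Definition sqdiff : 'M[R]_N := map_mx (fun a => a ^+ 2) (B - avg q A).

(** The pair of classes is dense, [B] is close in mean square to its density there, and the first
    class is not small. Along a closed walk every class occurs as a first class, so testing that one
    is enough. *)
Definition good (th tau s : R) (x y : 'I_N) : bool :=
  [&& th <= avg q A x y, avg q sqdiff x y <= tau ^+ 2 * avg q A x y ^+ 2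
    & s <= cls R q x].

Lemma sum_sqdiff : \sum_x \sum_y sqdiff x y = fnorm (B - avg q A) ^+ 2.
Proof.
by rewrite fnorm2; apply: eq_bigr => x _; apply: eq_bigr => y _; rewrite mxE expr2.
Qed.

Lemma card_small_cls (s : R) : 0 <= s ->
  \sum_x (cls R q x < s)%R%:R <= s * #|C|%:R.
Proof.
move=> s0; apply: le_trans (ler_wpM2l s0 (sum_inv_cls R q)).
rewrite mulr_sumr; apply: ler_sum => x _.
have [h|h] := ltP; last by rewrite divr_ge0 // ltW ?cls_gt0.
by rewrite ler_pdivlMr ?cls_gt0 // mul1r ltW.
Qed.

(** Classes below size [s] cover at most s |C| <= eta N vertices. [spread], applied to their
    indicator vector, bounds its image by 2 eta N, and pairing with the all-ones vector costs sqrt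
    N. *)
Lemma small_cls_mass (kap s eta : R) :
  spread kap A^T -> 0 <= s -> 0 <= kap <= eta ^+ 2 -> 0 <= eta ->
  s * #|C|%:R <= eta * N%:R ->
  \sum_x \sum_y A x y * (cls R q x < s)%R%:R <= 2 * eta * N%:R * Num.sqrt N%:R.
Proof.
move=> sA s0 /andP[k0 k1] e0 hs.
pose u : 'cV[R]_N := \col_x (cls R q x < s)%R%:R.
pose one : 'cV[R]_N := const_mx 1.
have -> : \sum_x \sum_y A x y * (cls R q x < s)%R%:R = dotm (A^T *m u) one.
  rewrite dotm_mull trmxK; apply: eq_bigr => x _; rewrite big_ord1 !mxE mulr_sumr.
  by apply: eq_bigr => y _; rewrite mxE mulr1 mulrC.
have f1 : fnorm one = Num.sqrt N%:R.
  rewrite /fnorm; congr Num.sqrt; rewrite /dotm.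
  under eq_bigr do rewrite big_ord1 !mxE mulr1.
  by rewrite sumr_const card_ord.
apply: le_trans (dotm_le _ _) _; rewrite f1; apply: ler_wpM2r; first exact: sqrtr_ge0.
have hN : 0 <= N%:R :> R by rewrite ler0n.
have l1u : l1 u <= eta * N%:R.
  apply: le_trans hs; apply: le_trans (card_small_cls s0).
  by apply: ler_sum => x _; rewrite mxE ger0_norm ?ler0n.
have fu : fnorm u ^+ 2 <= N%:R.
  rewrite fnorm2 -[leRHS]mulr1 -[N in leRHS]card_ord mulr_natl -sumr_const.
  apply: ler_sum => x _; rewrite big_ord1 mxE; case: ltP => _; rewrite ?mulr1 ?mulr0 //.
have en0 : 0 <= eta * N%:R by rewrite mulr_ge0.
rewrite -(ler_pXn2r (n := 2)) ?nnegrE ?fnorm_ge0 // -?mulrA ?mulr_ge0 //.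
apply: le_trans (sA u) _.
have h1 : l1 u ^+ 2 <= (eta * N%:R) ^+ 2 by rewrite lerXn2r ?nnegrE ?l1_ge0.
have h2 : kap * N%:R * fnorm u ^+ 2 <= (eta * N%:R) ^+ 2.
  apply: (@le_trans _ _ (eta ^+ 2 * N%:R * N%:R)); last by rewrite exprMn -mulrA.
  apply: ler_pM fu; [by rewrite mulr_ge0|exact: sqr_ge0|by rewrite ler_wpM2r].
rewrite [leRHS]exprMn; apply: le_trans (lerD h2 h1) _.
rewrite -mulr2n -[leLHS]mulr_natl ler_wpM2r ?sqr_ge0 //.
by rewrite -natrX ler_nat.
Qed.

(** The three terms account for sparse pairs, irregular pairs and small first classes. *)
Lemma bad_mass (kap th tau s eta : R) :
  (forall x y, 0 <= A x y) -> 0 < th -> 0 < tau ->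
  spread kap A^T -> 0 <= s -> 0 <= kap <= eta ^+ 2 -> 0 <= eta ->
  s * #|C|%:R <= eta * N%:R ->
  \sum_x \sum_y A x y * (~~ good th tau s x y)%:R <=
  th * N%:R ^+ 2 + fnorm (B - avg q A) ^+ 2 / (th * tau ^+ 2)
    + 2 * eta * N%:R * Num.sqrt N%:R.
Proof.
move=> A0 th0 tau0 sA s0 hk e0 hs.
(* A weight that is constant on pairs of classes has the same sum against [A] and against
   [avg q A]. *)
have transfer (b : 'I_N -> 'I_N -> bool) :
    (forall x x' y y', q x = q x' -> q y = q y' -> b x y = b x' y') ->
    \sum_x \sum_y A x y * (b x y)%:R = \sum_x \sum_y avg q A x y * (b x y)%:R.
  move=> hb; pose Bd : 'M[R]_N := \matrix_(x, y) (b x y)%:R.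
  have e (M : 'M[R]_N) : \sum_x \sum_y M x y * (b x y)%:R = dotm M Bd.
    by apply: eq_bigr => x _; apply: eq_bigr => y _; rewrite mxE.
  rewrite !e dotm_avg; congr dotm; rewrite /avg Emx_mul_const => [|x y j h]; last first.
    by rewrite !mxE (hb x y j j h).
  rewrite -[RHS]trmxK trmx_mul Emx_sym Emx_mul_const ?trmxK // => x y j h.
  by rewrite !mxE (hb j j x y erefl h).
rewrite transfer; last first.
  move=> x x' y y' hx hy; rewrite /good.
  by rewrite !(avg_const _ hx hy) (cls_eq _ hx).
have := small_cls_mass sA s0 hk e0 hs; rewrite (transfer (fun x _ => cls R q x < s)%R); last first.
  by move=> x x' y y' hx _; rewrite (cls_eq _ hx).
set Z := \sum_x _ => hZ.
have thtau : 0 < th * tau ^+ 2 by rewrite mulr_gt0 ?exprn_gt0.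
apply: (@le_trans _ _ (\sum_x \sum_y (th + avg q sqdiff x y / (th * tau ^+ 2) +
   avg q A x y * (cls R q x < s)%R%:R))).
  apply: ler_sum => x _; apply: ler_sum => y _.
  have P0 : 0 <= avg q A x y by apply: avg_ge0.
  have S0 : 0 <= avg q sqdiff x y by apply: avg_ge0 => i j; rewrite mxE sqr_ge0.
  have c1 : 0 <= avg q sqdiff x y / (th * tau ^+ 2) by rewrite divr_ge0 // ltW.
  have c2 : 0 <= avg q A x y * (cls R q x < s)%R%:R by rewrite mulr_ge0 ?ler0n.
  rewrite /good; have [h1|h1] := leP th; last first.
    rewrite mulr1 -addrA -[leLHS]addr0 lerD ?addr_ge0 //; exact: ltW.
  (* On a dense irregular pair, with P = [avg q A x y], the mean square exceeds tau^2 P^2 >= tau^2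
     th P, so P is at most the mean square over th tau^2. *)
  have [h2|h2] := leP (avg q sqdiff x y); last first.
    rewrite mulr1 -[leLHS]addr0 lerD // -[leLHS]add0r lerD ?(ltW th0) //.
    rewrite ler_pdivlMr //; apply: le_trans (ltW h2).
    have -> : avg q A x y * (th * tau ^+ 2) = tau ^+ 2 * (avg q A x y * th) by ring.
    by rewrite ler_wpM2l ?sqr_ge0 // expr2 ler_wpM2l.
  by rewrite /= -ltNge -[leLHS]add0r lerD // addr_ge0 // ltW.
under eq_bigr => x _ do rewrite !big_split /=.
rewrite !big_split /= -/Z; apply: lerD => //; apply: lerD.
  under eq_bigr => x _ do rewrite sumr_const card_ord.
  by rewrite sumr_const card_ord -mulrnA -[_ *+ _]mulr_natr natrM expr2.
under eq_bigr => x _ do rewrite -mulr_suml.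
by rewrite -mulr_suml sum_avg sum_sqdiff.
Qed.

End Cleaning.

Section Pigeonhole.
Variables (R : rcfType) (N : nat).

Definition adj (a : rel 'I_N) : 'M[R]_N := \matrix_(x, y) (a x y)%:R.

(** At each of the [k] positions an edge determines its walk, so a bad edge spoils at most [k]
    walks; fewer than |T| / k bad edges cannot spoil all of them. *)
Lemma exists_good_cycle (a g : rel 'I_N) (k : nat) (T : finType) (c : T -> nat -> 'I_N) :
  (forall t i, a (c t i) (c t i.+1)) ->
  (forall t t' i, c t i = c t' i -> c t i.+1 = c t' i.+1 -> t = t') ->
  k%:R * (\sum_x \sum_y adj a x y * (~~ g x y)%:R) < #|T|%:R ->
  exists t, forall i, (i < k)%N -> g (c t i) (c t i.+1).
Proof.
move=> ha hinj hlt.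
have [/existsP[t /forallP ht]|hno] := boolP [exists t, [forall i : 'I_k, g (c t i) (c t i.+1)]].
  by exists t => i ik; have := ht (Ordinal ik).
exfalso; move: hlt; apply/negP; rewrite -leNgt.
pose bad := [pred xy : 'I_N * 'I_N | a xy.1 xy.2 && ~~ g xy.1 xy.2].
have -> : \sum_x \sum_y adj a x y * (~~ g x y)%:R = #|bad|%:R.
  rewrite pair_bigA -sum1_card natr_sum [RHS]big_mkcond; apply: eq_bigr => [[x y]] _ /=.
  by rewrite mxE inE /=; case: (a x y); case: (g x y); rewrite /= ?mulr0 ?mul0r ?mulr1.
rewrite -natrM ler_nat.
have hT : (#|T| <= \sum_(i < k) #|[pred t | ~~ g (c t i) (c t i.+1)]|)%N.
  under eq_bigr => i _ do rewrite -sum1_card.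
  rewrite -sum1_card; under [leqRHS]eq_bigr => i _ do rewrite big_mkcond /=.
  rewrite exchange_big; apply: leq_sum => t _.
  move: hno; rewrite negb_exists => /forallP /(_ t); rewrite negb_forall => /existsP[i hi].
  by rewrite (bigD1 i) //= inE hi.
apply: leq_trans hT _; rewrite -[k in leqRHS]card_ord -sum_nat_const; apply: leq_sum => i _.
have inj : injective (fun t => (c t i, c t i.+1)).
  by move=> t t' [h1 h2]; apply: hinj h1 h2.
rewrite -(card_image inj); apply: subset_leq_card; apply/subsetP => xy /imageP[t ht ->].
by rewrite inE /= ha; move: ht; rewrite inE.
Qed.

End Pigeonhole.

Section Removal.
Variable R : archiRcfType.

(** The chord of the convex function (1 + tau)^k over [0, 1]. *)
Lemma exp1D_le (tau : R) (k : nat) : 0 <= tau <= 1 ->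
  (1 + tau) ^+ k <= 1 + (2 ^+ k - 1) * tau.
Proof.
move=> /andP[t0 t1]; elim: k => [|k IH]; first by rewrite !expr0 subrr mul0r addr0.
rewrite exprS; apply: le_trans (ler_wpM2l _ IH) _; first by rewrite addr_ge0.
have h : (2 ^+ k - 1) * (tau * tau) <= (2 ^+ k - 1) * tau.
  apply: ler_wpM2l; last by rewrite -[leRHS]mulr1 ler_wpM2l.
  by rewrite subr_ge0 exprn_ege1 // ler1n.
rewrite [2 ^+ k.+1]exprS -subr_ge0.
have -> : 1 + (2 * 2 ^+ k - 1) * tau - (1 + tau) * (1 + (2 ^+ k - 1) * tau) =
  (2 ^+ k - 1) * tau - (2 ^+ k - 1) * (tau * tau) by ring.
by rewrite subr_ge0.
Qed.

Lemma ex_small_tau (k : nat) : exists tau : R, 0 < tau /\ (1 + tau) ^+ k <= 3 / 2.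
Proof.
have p0 : 0 < (2 ^+ k.+1)^-1 :> R by rewrite invr_gt0 exprn_gt0.
exists (2 ^+ k.+1)^-1; split => //.
have p1 : (2 ^+ k.+1)^-1 <= 1 :> R by rewrite invf_le1 ?exprn_gt0 // exprn_ege1 // ler1n.
apply: le_trans (@exp1D_le _ k _) _; first by rewrite ltW.
have -> : (3 / 2 : R) = 1 + 2^-1 by field.
rewrite lerD2l exprS invfM mulrCA -[leRHS]mulr1 ler_wpM2l ?invr_ge0 //.
by rewrite ler_pdivrMr ?exprn_gt0 // mul1r gerBl.
Qed.

(* [F] is the graph restricted to a cycle of classes, [G] its fine average and
   [J] its coarse average, which is constant on each pair of classes. *)
Lemma count_lower (N k : nat) (A B P : 'M[R]_N) (C : finType) (q : 'I_N -> C)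
    (X : nat -> 'I_N) (g tau Cs th s : R) (w := Num.sqrt N%:R : R) :
  (5 <= k)%N -> (0 < N)%N -> 0 <= g -> 0 < tau -> (1 + tau) ^+ k <= 3 / 2 -> 4 <= Cs ->
  (forall x y, 0 <= A x y) -> P = avg q A ->
  opb (2 * w) A -> fnorm (A^T *m A) <= Cs * N%:R ->
  opb (2 * w) B -> fnorm B <= 2 * w ->
  opb (g * w) (A - B) -> 0 < th -> 0 < s ->
  (forall i, X (i + k)%N = X i) ->
  (forall i, [/\ th <= P (X i) (X i.+1),
     fnorm (res q (X i) (X i.+1) (B - P)) ^+ 2 <=
       tau ^+ 2 * P (X i) (X i.+1) ^+ 2 * (cls R q (X i) * cls R q (X i.+1)) &
     s <= cls R q (X i)]) ->
  2^-1 * (th * s) ^+ k - k%:R * (g * Cs ^+ 2 * 2 ^+ k) * w ^+ k <= \tr (A ^+ k).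
Proof.
move=> k5 N0 g0 tau0 tauk Cs4 A0 PE oA gA oB fB oAB th0 s0 Xk hX.
have w0 : 0 < w by rewrite sqrtr_gt0 ltr0n.
have w2 : w ^+ 2 = N%:R by rewrite sqr_sqrtr ?ler0n.
have w20 : 0 <= 2 * w by rewrite mulr_ge0 ?ltW.
have gw0 : 0 <= g * w by rewrite mulr_ge0 // ltW.
have Cs0 : 0 <= Cs by apply: le_trans Cs4; rewrite ler0n.
pose r i (M : 'M[R]_N) := res q (X i) (X i.+1) M.
pose F i := r i A; pose G i := r i B; pose J i := r i P.
pose d i := P (X i) (X i.+1).
pose W i := d i * Num.sqrt (cls R q (X i)) * Num.sqrt (cls R q (X i.+1)).
have d0 i : 0 < d i by have [h _ _] := hX i; apply: lt_le_trans h.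
have JE i : J i = d i *: (ind R q (X i) *m (ind R q (X i.+1))^T).
  apply: res_const => a b ha hb; rewrite PE; apply: avg_const; exact: esym.
have indN x : fnorm (ind R q x) = Num.sqrt (cls R q x) by rewrite /fnorm dotm_ind.
have fJ i : fnorm (J i) <= W i.
  rewrite JE fnormZ gtr0_norm // /W -mulrA ler_pM2l //.
  by apply: le_trans (fnorm_mul _ _) _; rewrite fnorm_tr !indN.
have W0 i : 0 <= W i by apply: le_trans (fnorm_ge0 _) (fJ i).
have fGJ i : fnorm (G i - J i) <= tau * W i.
  rewrite -resB; have [_ h _] := hX i.
  rewrite -(ler_pXn2r (n := 2)) ?nnegrE ?fnorm_ge0 ?(mulr_ge0 (ltW tau0) (W0 i)) //.
  apply: le_trans h _; rewrite /W !exprMn !sqr_sqrtr ?(ltW (cls_gt0 _ _ _)) //.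
  by rewrite /d !mulrA.
have nF i : nice (2 * w) (Cs * N%:R) (F i).
  split; first exact: opb_res.
  by apply: le_trans (gram_res _ _ _ A0) _.
have nG i : nice (2 * w) (Cs * N%:R) (G i).
  split; first exact: opb_res.
  (* For [G i] the Gram bound comes from operator norm times Frobenius norm, both at most 2w; this
     is where 4 <= Cs enters. *)
  apply: le_trans (opb_mull _ w20 (opb_tr w20 (opb_res _ _ _ w20 oB))) _.
  apply: (@le_trans _ _ (2 * w * (2 * w))).
    by apply: ler_wpM2l => //; apply: le_trans (fnorm_res _ _ _ _) fB.
  have -> : 2 * w * (2 * w) = 4 * w ^+ 2 by ring.
  by rewrite w2 ler_wpM2r.
have dFG i : opb (g * w) (F i - G i) by rewrite -resB; apply: opb_res.
pose l := iota 0 k.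
have lE : l = 0%N :: iota 1 k.-1 by rewrite /l; case: (k) k5.
have sl : size l = k by rewrite size_iota.
have h1 : \tr (\prod_(i <- l) F i) <= \tr (A ^+ k).
  have FA i a b : 0 <= F i a b <= A a b by apply: res_bounds.
  by apply: ler_sum => x _; have /andP[_] := prod_mx_le l FA x x; rewrite sl.
have h2 : `|\tr (\prod_(i <- l) F i) - \tr (\prod_(i <- l) G i)| <=
    k%:R * (g * Cs ^+ 2 * 2 ^+ k) * w ^+ k.
  have := @trace_telescope _ _ (g * w) (2 * w) (Cs * N%:R) gw0 w20 F G [::] l.
  rewrite big_nil !mul1r add0n sl => /(_ k5 nF nG dFG) h.
  apply: le_trans (h _) _ => // {h}.
  rewrite -[leRHS]mulrA ler_wpM2l ?ler0n //.
  have -> : g * Cs ^+ 2 * 2 ^+ k * w ^+ k = (g * Cs ^+ 2 * w ^+ k) * 2 ^+ k by ring.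
  have -> : g * w * (Cs * N%:R) ^+ 2 * (2 * w) ^+ (k - 5) =
      (g * Cs ^+ 2 * w ^+ k) * 2 ^+ (k - 5).
    have -> : w ^+ k = w ^+ (k - 5) * w ^+ 5 by rewrite -exprD subnK.
    by rewrite -w2 !exprMn; move: (w ^+ (k - 5)) (2 ^+ (k - 5)) => a b; ring.
  apply: ler_wpM2l; first by do 2?[apply: mulr_ge0] => //; rewrite exprn_ge0 // ltW.
  by rewrite ler_eXn2l ?ltr1n // leq_subr.
(* The relative error (1 + tau)^k - 1 is at most 1/2, so half of the main term survives. *)
have h3 : `|\tr (\prod_(i <- l) G i) - \tr (\prod_(i <- l) J i)| <=
    2^-1 * \prod_(i <- l) W i.
  have l1 : iota 1 k.-1 != [::] by case: (k) k5 => [|[]].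
  rewrite lE; apply: le_trans (trace_telescope_fnorm 0 l1 (ltW tau0) fJ fGJ) _.
  rewrite ler_wpM2r ?prodr_ge0 // size_iota prednK ?(leq_trans _ k5) //.
  by rewrite lerBlDr; apply: le_trans tauk _; rewrite le_eqVlt; apply/orP; left; apply/eqP; field.
(* Rotating the cycle merges the factors sqrt [cls] of neighbouring pairs into one [cls] for each
   vertex of the cycle. *)
have hcyc (f : nat -> R) : (forall i, f (i + k)%N = f i) ->
   \prod_(i <- l) f i.+1 = \prod_(i <- l) f i.
  move=> fk; have f0k : f k = f 0%N by rewrite -(fk 0%N).
  rewrite /l -{1 2}[k]subn0 -/(index_iota 0 k); move: f0k.
  case: (k) k5 => // k' _ fk'; rewrite big_nat_recr //= big_nat_recl //=.
  by rewrite fk' mulrC.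
have WE : \prod_(i <- l) W i = (\prod_(i <- l) d i) * \prod_(i <- l) cls R q (X i).
  rewrite /W !big_split /= (hcyc (fun i => Num.sqrt (cls R q (X i)))) => [|i]; last by rewrite Xk.
  rewrite -mulrA -big_split /=; congr (_ * _); apply: eq_bigr => i _.
  by rewrite -expr2 sqr_sqrtr // ltW ?cls_gt0.
have h4 : \tr (\prod_(i <- l) J i) = \prod_(i <- l) W i.
  rewrite WE (eq_bigr _ (fun i _ => JE i)).
  have X0 : X k = X 0%N by rewrite -(Xk 0%N).
  move: X0; rewrite /l; case: (k) k5 => // k' _ X0.
  rewrite (prod_rank1 (fun i => ind R q (X i))) linearZ /= -mulrA; congr (_ * _).
  rewrite X0 mxtrace_mulC -dotmE dotm_ind big_cons mulrC; congr (_ * _).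
  by apply: eq_bigr => i _; rewrite dotm_ind.
have h5 : (th * s) ^+ k <= \prod_(i <- l) W i.
  rewrite WE -big_split /=.
  have -> : (th * s) ^+ k = \prod_(i <- l) (th * s).
    by rewrite big_const_seq count_predT sl -Monoid.iteropE.
  apply: ler_prod => i _; rewrite (mulr_ge0 (ltW th0) (ltW s0)) /=.
  by have [a _ b] := hX i; rewrite ler_pM ?(ltW th0) ?(ltW s0).
have e1 := ler_norm (\tr (\prod_(i <- l) G i) - \tr (\prod_(i <- l) F i)).
rewrite distrC in e1; have e2 := le_trans e1 h2.
have e3 := ler_norm (\tr (\prod_(i <- l) J i) - \tr (\prod_(i <- l) G i)).
rewrite distrC in e3; have e4 := le_trans e3 h3; rewrite h4 in e4.
rewrite lerBlDr; apply: (@le_trans _ _ (\tr (\prod_(i <- l) G i))); last first.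
  by rewrite -lerBlDl; apply: le_trans e2; rewrite lerD2l lerN2.
rewrite lerBlDr -lerBlDl in e4; apply: le_trans e4.
apply: (@le_trans _ _ (2^-1 * \prod_(i <- l) W i)); first by rewrite ler_wpM2l ?invr_ge0.
by rewrite le_eqVlt; apply/orP; left; apply/eqP; field.
Qed.

(** The edge-disjoint closed walks [c t] stand for the degenerate k-gons. Bad pairs carry too little
    mass to meet all of them, and [count_lower] is applied along the classes of a walk that avoids
    them. *)
Theorem many_closed_walks (eps Cs : R) (k : nat) :
  0 < eps -> 4 <= Cs -> (5 <= k)%N ->
  exists delta kap0 : R, [/\ 0 < delta, 0 < kap0 &
  forall (N : nat) (a : rel 'I_N) (kap : R) (A := adj R a) (w := Num.sqrt N%:R),
    (0 < N)%N -> 0 <= kap <= kap0 -> spread kap A -> spread kap A^T ->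
    fnorm (A^T *m A) <= Cs * N%:R ->
  forall (T : finType) (c : T -> nat -> 'I_N),
    (forall t i, c t (i + k)%N = c t i) ->
    (forall t i, a (c t i) (c t i.+1)) ->
    (forall t t' i, c t i = c t' i -> c t i.+1 = c t' i.+1 -> t = t') ->
    eps * N%:R * w <= #|T|%:R -> delta * w ^+ k <= \tr (A ^+ k)].
Proof.
move=> e0 Cs4 k5.
have k0 : 0 < k%:R :> R by rewrite ltr0n (leq_trans _ k5).
have Cs0 : 0 < Cs by apply: lt_le_trans Cs4; rewrite ltr0n.
have [tau [tau0 tauk]] := ex_small_tau k.
(* With th = c0 / w and 2 eta = c0, each of the three terms of [bad_mass] is at most c0 N w; [k]
   times their sum is 3/8 of eps N w, below |T|. *)
have [c0 c0E c00] : exists2 c0, c0 = eps / (8 * k%:R) & 0 < c0.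
  by eexists; first reflexivity; rewrite divr_gt0 // mulr_gt0.
have [eta etaE eta0] : exists2 eta, eta = eps / (16 * k%:R) & 0 < eta.
  by eexists; first reflexivity; rewrite divr_gt0 // mulr_gt0.
(* The first bound controls the irregular pairs, the bound 1/4 gives [fnorm (B - P)] at most w /
   2. *)
pose zeta := Num.min (c0 ^+ 2 * tau ^+ 2) 4^-1.
have q4 : 0 < 4^-1 :> R by rewrite invr_gt0.
have z0 : 0 < zeta by rewrite lt_min q4 (mulr_gt0 (exprn_gt0 2 c00) (exprn_gt0 2 tau0)).
(* For the thresholds [th] and [s] chosen below, (th s)^k equals [be m] times w^k. *)
pose be m := (c0 * eta / m.+1%:R) ^+ k.
have ce0 : 0 < c0 * eta by apply: mulr_gt0.
have S0 m : 0 < m.+1%:R :> R by rewrite ltr0n.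
have be0 m : 0 < be m by apply: exprn_gt0; apply: divr_gt0.
(* Chosen so that the telescoping error is be m / 4, half of the main term be m / 2. *)
pose gam m := be m / (4 * k%:R * Cs ^+ 2 * 2 ^+ k).
have den0 : 0 < 4 * k%:R * Cs ^+ 2 * 2 ^+ k.
  apply: mulr_gt0; last by rewrite exprn_gt0 ?ltr0n.
  by apply: mulr_gt0; [rewrite mulr_gt0|rewrite exprn_gt0].
have gam0 m : 0 < gam m by rewrite divr_gt0.
have [M [kap1 [kap10 strong]]] := strong_regularity gam0 z0.
(* The class bound [m] depends on the graph, but m <= M and [be] is decreasing. The last bound on
   kap keeps the energy of [P] below 5N / 4. *)
exists (4^-1 * be M), (Num.min (Num.min kap1 (eta ^+ 2)) (Num.min 1 (4 * M.+1%:R)^-1)).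
split; [by apply: mulr_gt0| |].
  by rewrite !lt_min kap10 ltr01 exprn_gt0 //= invr_gt0 mulr_gt0.
move=> N a kap A w N0 /andP[kap_ge0]; rewrite !le_min => /andP[/andP[ka1 ka2] /andP[ka3 ka4]].
move=> sA sAt gA T c ck ca cinj hT.
have w0 : 0 < w by rewrite sqrtr_gt0 ltr0n.
have w2 : w ^+ 2 = N%:R by rewrite sqr_sqrtr ?ler0n.
have Np : 0 < N%:R :> R by rewrite ltr0n.
have A0 x y : 0 <= A x y by rewrite mxE ler0n.
have kapP : 0 <= kap <= kap1 by rewrite kap_ge0.
have [m [C1 [C2 [q1 [q2 [ref C1m mM oD eD]]]]]] := strong N A kap N0 kapP sA sAt.
set B := avg q2 A in oD eD; set P := avg q1 A in eD.
pose th := c0 / w; pose s := eta * N%:R / m.+1%:R.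
have th0 : 0 < th by rewrite divr_gt0.
have s0 : 0 < s by apply: divr_gt0 => //; apply: mulr_gt0.
have mass := @bad_mass _ _ _ q1 A B kap th tau s eta A0 th0 tau0 sAt (ltW s0) _ (ltW eta0) _.
have {}mass : \sum_x \sum_y A x y * (~~ good q1 A B th tau s x y)%:R <=
    (3 / 8 * eps / k%:R) * N%:R * w.
  apply: le_trans (mass _ _) _; first by rewrite kap_ge0.
    rewrite /s -!mulrA; apply: (ler_wpM2l (ltW eta0)); apply: ler_piMr; first exact: ltW.
    by rewrite mulrC ler_pdivrMr // mul1r ler_nat (leq_trans C1m).
  have -> : (3 / 8 * eps / k%:R) * N%:R * w = c0 * N%:R * w + c0 * N%:R * w + 2 * eta * N%:R * w.
    by rewrite c0E etaE; field; rewrite gt_eqF.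
  rewrite lerD2r; apply: lerD.
    by rewrite /th -w2 le_eqVlt; apply/orP; left; apply/eqP; field; rewrite gt_eqF.
  rewrite -/P ler_pdivrMr; last by rewrite mulr_gt0 // exprn_gt0.
  apply: le_trans eD _.
  have -> : c0 * N%:R * w * (th * tau ^+ 2) = (c0 ^+ 2 * tau ^+ 2) * N%:R.
    by rewrite /th; field; rewrite gt_eqF.
  by rewrite ler_wpM2r ?ler0n // ge_min lexx.
have [|t ht] := @exists_good_cycle R N a (good q1 A B th tau s) k T c ca cinj _.
  apply: lt_le_trans hT; apply: le_lt_trans (ler_wpM2l (ltW k0) mass) _.
  have -> : k%:R * (3 / 8 * eps / k%:R * N%:R * w) = 3 / 8 * (eps * N%:R * w).
    by field; rewrite gt_eqF.
  by rewrite gtr_pMl ?mulr_gt0 // ltr_pdivrMr ?ltr0n // mul1r ltr_nat.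
have per i j : c t (j + i * k)%N = c t j.
  by elim: i => [|i IH]; rewrite ?mul0n ?addn0 // mulSn addnCA [(k + _)%N]addnC ck IH.
have ht' i : good q1 A B th tau s (c t i) (c t i.+1).
  rewrite (divn_eq i k) [(_ * k + _)%N]addnC -addSn !per.
  by apply: ht; rewrite ltn_mod (leq_trans _ k5).
have kap01 : 0 <= kap <= 1 by rewrite kap_ge0.
have fP : fnorm P <= 3 / 2 * w.
  apply: fnorm_le; first by rewrite mulr_ge0 ?divr_ge0 ?ltW ?ltr0n.
  rewrite -fnorm2 exprMn w2; apply: le_trans (energy_le q1 kap_ge0 sAt) _.
  rewrite ler_wpM2r ?ler0n //; apply: (@le_trans _ _ (4^-1 + 1)).
    rewrite lerD2r; apply: le_trans (ler_wpM2r (ler0n _ _) ka4) _.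
    rewrite invfM -mulrA ler_piMr ?invr_ge0 ?ler0n //.
    rewrite mulrC ler_pdivrMr ?ltr0n // mul1r ler_nat.
    by rewrite (leq_trans C1m) // (leq_trans mM).
  lra.
have fBP : fnorm (B - P) <= 1 / 2 * w.
  apply: fnorm_le; first by rewrite mulr_ge0 ?divr_ge0 ?ltW ?ltr0n.
  rewrite -fnorm2 exprMn w2; apply: le_trans eD _; rewrite ler_wpM2r ?ler0n //.
  by rewrite ge_min; apply/orP; right; lra.
have fB : fnorm B <= 2 * w.
  have -> : B = P + (B - P) by rewrite addrC subrK.
  apply: le_trans (fnormD _ _) _; have -> : 2 * w = 3 / 2 * w + 1 / 2 * w by field.
  exact: lerD.
have oA := spread_opb kap01 sA.
have oB := spread_opb kap01 (spread_avg q2 kap_ge0 sA).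
have := @count_lower N k A B P C1 q1 (c t) (gam m) tau Cs th s k5 N0 (ltW (gam0 m)) tau0 tauk
  Cs4 A0 erefl oA gA oB fB oD th0 s0 (ck t) _.
have hX i : [/\ th <= P (c t i) (c t i.+1),
     fnorm (res q1 (c t i) (c t i.+1) (B - P)) ^+ 2 <=
       tau ^+ 2 * P (c t i) (c t i.+1) ^+ 2 * (cls R q1 (c t i) * cls R q1 (c t i.+1)) &
     s <= cls R q1 (c t i)].
  have /and3P[g1 g2 g3] := ht' i; split => //.
  by rewrite fnorm2_res ler_wpM2r // mulr_ge0 // ltW ?cls_gt0.
move=> /(_ hX); apply: le_trans; rewrite -/w.
have -> : 2^-1 * (th * s) ^+ k - k%:R * (gam m * Cs ^+ 2 * 2 ^+ k) * w ^+ k = 4^-1 * be m * w ^+ k.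
  have -> : th * s = c0 * eta / m.+1%:R * w.
    by rewrite /th /s -w2; move: (m.+1%:R) (S0 m) => m1 hm1; field; rewrite !gt_eqF.
  rewrite exprMn -/(be m).
  have -> : k%:R * (gam m * Cs ^+ 2 * 2 ^+ k) = 4^-1 * be m.
    rewrite /gam; move: (2 ^+ k) (be m) den0 => p b den0.
    have {den0} : 4 * k%:R * Cs ^+ 2 * p != 0 by rewrite gt_eqF.
    rewrite !mulf_eq0 !negb_or => /andP[/andP[_ h1] h2]; field.
    by rewrite h2 !gt_eqF.
  by field.
apply: ler_wpM2r; first by rewrite exprn_ge0 // ltW.
apply: ler_wpM2l; first by rewrite invr_ge0.
have hm j : 0 <= c0 * eta / j.+1%:R by rewrite divr_ge0 // ltW.
rewrite /be lerXn2r ?nnegrE //; apply: ler_wpM2l; first exact: ltW.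
by rewrite lef_pV2 ?posrE // ler_nat.
Qed.

End Removal.

(** * Graphs with few 4-cycles *)

Section Graphs.
Variables (R : rcfType) (N : nat).

Definition c4 (a : rel 'I_N) : nat :=
  #|[pred t : ('I_N * 'I_N) * ('I_N * 'I_N) |
     [&& t.1.1 != t.1.2, t.2.1 != t.2.2,
         a t.1.1 t.2.1, a t.1.2 t.2.1, a t.1.1 t.2.2 & a t.1.2 t.2.2]]|.

Definition codeg (a : rel 'I_N) (x x' : 'I_N) : nat := #|[pred y | a x y && a x' y]|.

Lemma adj_tr (a : rel 'I_N) : (adj R a)^T = adj R (fun x y => a y x).
Proof. by apply/matrixP => x y; rewrite !mxE. Qed.

Lemma c4_tr (a : rel 'I_N) : c4 (fun x y => a y x) = c4 a.
Proof.
pose f (t : ('I_N * 'I_N) * ('I_N * 'I_N)) := (t.2, t.1).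
have fi : injective f by move=> [t1 t2] [t3 t4] [-> ->].
rewrite /c4 -(card_image fi); apply: eq_card => -[[x x'] [y y']].
rewrite (mem_image fi _ ((y, y'), (x, x'))) !inE /=.
by case: (x != x'); case: (y != y'); case: (a x y); case: (a x y'); case: (a x' y); case: (a x' y').
Qed.

Lemma codegE (a : rel 'I_N) x x' : (codeg a x x')%:R = (adj R a *m (adj R a)^T) x x'.
Proof.
rewrite mxE /codeg -sum1_card natr_sum big_mkcond; apply: eq_bigr => y _.
by rewrite !mxE inE; case: (a x y); case: (a x' y); rewrite /= ?mulr1 ?mulr0.
Qed.

Lemma codegxx (a : rel 'I_N) x : (codeg a x x)%:R = \sum_y adj R a x y.
Proof.
rewrite codegE mxE; apply: eq_bigr => y _; rewrite !mxE.
by case: (a x y); rewrite ?mulr1 ?mulr0.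
Qed.

Lemma c4E (a : rel 'I_N) :
  (c4 a)%:R = \sum_x \sum_(x' | x' != x) (codeg a x x')%:R * ((codeg a x x')%:R - 1) :> R.
Proof.
rewrite /c4 -sum1_card natr_sum big_mkcond /= -(pair_bigA _ (fun t1 t2 =>
  if [&& t1.1 != t1.2, t2.1 != t2.2, a t1.1 t2.1, a t1.2 t2.1, a t1.1 t2.2 & a t1.2 t2.2]
  then 1 else 0 : R)).
rewrite -(pair_bigA _ (fun x x' => \sum_t2
  if [&& x != x', t2.1 != t2.2, a x t2.1, a x' t2.1, a x t2.2 & a x' t2.2] then 1 else 0 : R)) /=.
apply: eq_bigr => x _; rewrite [RHS]big_mkcond; apply: eq_bigr => x' _.
rewrite eq_sym; case: eqP => _ /=; first by rewrite big1.
rewrite mulrBr mulr1 /codeg -!sum1_card !natr_sum mulr_suml.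
rewrite -(pair_bigA _ (fun y y' =>
  if [&& y != y', a x y, a x' y, a x y' & a x' y'] then 1 else 0 : R)) /=.
rewrite -sumrB [RHS]big_mkcond /=; apply: eq_bigr => y _.
rewrite mul1r inE.
case: (boolP (a x y && a x' y)) => [/andP[h1 h2]|h]; last first.
  rewrite big1 // => y' _; move: h; rewrite negb_and.
  by case: (a x y); case: (a x' y); rewrite //= ?andbF.
rewrite [in RHS]big_mkcond (bigD1 y) //= eqxx add0r.
rewrite [in RHS](bigD1 y) //= !inE h1 h2 /= addrAC subrr add0r.
by apply: eq_bigr => y' hy; rewrite inE eq_sym hy.
Qed.

Lemma codeg_excess (n : nat) :
  (n%:R <= 1 + (n.-1)%:R :> R) /\ (n.-1%:R ^+ 2 <= n%:R * (n%:R - 1) :> R).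
Proof.
case: n => [|n] /=; first by rewrite addr0 ler01 expr0n mul0r.
rewrite nat1r lexx -natr1 addrK expr2; split => //.
by rewrite ler_wpM2r ?ler0n // lerDl.
Qed.

(** The entries of A A^T are codegrees. The diagonal is at most Delta; off it, a codegree is at most
    1 plus its excess over 1. The ones contribute the squared l1 norm, and the excess matrix [E] has
    Frobenius norm at most [Z] since (n - 1)^2 <= n (n - 1) is counted by 4-cycles. *)
Lemma spread_adj (a : rel 'I_N) (kap Delta Z : R) :
  (forall x, \sum_y adj R a x y <= Delta) -> 0 <= Z -> (c4 a)%:R <= Z ^+ 2 ->
  Delta + Z <= kap * N%:R -> spread kap (adj R a)^T.
Proof.
move=> hD Z0 hZ hk v.
pose E : 'M[R]_N := \matrix_(x, x') (if x' == x then 0 else ((codeg a x x').-1)%:R).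
have fE : fnorm E <= Z.
  apply: fnorm_le => //; apply: le_trans hZ; rewrite c4E; apply: ler_sum => x _.
  rewrite [leRHS]big_mkcond; apply: ler_sum => x' _; rewrite mxE.
  case: eqP => _ /=; first by rewrite mul0r.
  by rewrite -expr2; have [] := codeg_excess (codeg a x x').
pose u : 'cV[R]_N := \col_x `|v x 0|.
have fu : fnorm u = fnorm v.
  rewrite /fnorm; congr Num.sqrt; apply: eq_bigr => x _; rewrite !big_ord1 !mxE.
  by rewrite -!expr2 real_normK ?num_real.
have dE (M : 'M[R]_N) (z : 'cV[R]_N) : dotm z (M *m z) = \sum_x \sum_x' z x 0 * z x' 0 * M x x'.
  apply: eq_bigr => x _; rewrite big_ord1 mxE mulr_sumr; apply: eq_bigr => x' _; ring.
rewrite fnorm2 dotm_mull trmxK mulmxA dE.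
apply: (@le_trans _ _ (\sum_x \sum_x' u x 0 * u x' 0 * ((x' == x)%:R * Delta + 1 + E x x'))).
  apply: ler_sum => x _; apply: ler_sum => x' _; rewrite -codegE !mxE.
  apply: (@le_trans _ _ (`|v x 0| * `|v x' 0| * (codeg a x x')%:R)).
    by apply: ler_wpM2r; rewrite ?ler0n // -normrM ler_norm.
  apply: ler_wpM2l; first by rewrite mulr_ge0.
  case: eqP => [->|_]; last by rewrite mul0r add0r; have [] := codeg_excess (codeg a x x').
  rewrite mul1r addr0 codegxx; apply: le_trans (hD x) _; by rewrite lerDl.
under eq_bigr => x _ do under eq_bigr => x' _ do rewrite !mulrDr mulr1.
under eq_bigr => x _ do rewrite !big_split /=.
rewrite !big_split /= -dE.
have -> : \sum_x \sum_x' u x 0 * u x' 0 = l1 v ^+ 2.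
  rewrite expr2 /l1 mulr_suml; apply: eq_bigr => x _; rewrite mulr_sumr.
  by apply: eq_bigr => x' _; rewrite !mxE.
have -> : \sum_x \sum_x' u x 0 * u x' 0 * ((x' == x)%:R * Delta) = Delta * fnorm v ^+ 2.
  rewrite -fu fnorm2 mulr_sumr; apply: eq_bigr => x _; rewrite (bigD1 x) //= eqxx.
  rewrite big1 ?addr0 => [|x' /negbTE ->]; last by rewrite mul0r mulr0.
  by rewrite big_ord1 mul1r mulrC.
rewrite addrAC lerD2r; apply: le_trans (ler_wpM2r (sqr_ge0 _) hk).
rewrite [leRHS]mulrDl lerD2l; apply: le_trans (dotm_le _ _) _; rewrite fu.
apply: le_trans (ler_wpM2l (fnorm_ge0 _) (fnorm_mul _ _)) _.
by rewrite fu mulrCA -expr2 ler_wpM2r ?sqr_ge0.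
Qed.

(** Diagonal codegrees are degrees; off the diagonal n^2 <= 1 + 2 n (n - 1). *)
Lemma gram_adj (a : rel 'I_N) (Delta : R) : 0 <= Delta ->
  (forall x, \sum_y adj R a x y <= Delta) ->
  fnorm ((adj R a)^T *m adj R a) ^+ 2 <= N%:R * Delta ^+ 2 + N%:R ^+ 2 + 2 * (c4 a)%:R.
Proof.
move=> D0 hD; rewrite -fnorm_gram_tr fnorm2 c4E /dotm mulr_sumr.
have -> : N%:R * Delta ^+ 2 = \sum_(x < N) Delta ^+ 2 by rewrite sumr_const card_ord mulr_natl.
have -> : N%:R ^+ 2 = \sum_(x < N) N%:R :> R by rewrite sumr_const card_ord -[RHS]mulr_natl.
rewrite -!big_split /=; apply: ler_sum => x _.
under eq_bigr => x' _ do rewrite -codegE -expr2.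
rewrite (bigD1 x) //= -addrA; apply: lerD.
  by rewrite codegxx lerXn2r ?nnegrE ?sumr_ge0 // => y _; rewrite mxE ler0n.
apply: (@le_trans _ _ (\sum_(x' < N | x' != x) 1 +
    2 * \sum_(x' < N | x' != x) (codeg a x x')%:R * ((codeg a x x')%:R - 1))); last first.
  by rewrite lerD2r sumr_const ler_nat -[leqRHS]card_ord max_card.
rewrite mulr_sumr -big_split /=.
apply: ler_sum => x' _; case: (codeg a x x') => [|n]; first by rewrite expr0n mul0r mulr0 addr0.
rewrite -natr1 addrK -subr_ge0.
have -> : 1 + 2 * ((n%:R + 1) * n%:R) - (n%:R + 1) ^+ 2 = n%:R ^+ 2 :> R by ring.
exact: sqr_ge0.
Qed.

(* A graph with more than about [N^(3/2)] edges has the number of 4-cycles of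
   a random graph, by Cauchy-Schwarz. *)
Lemma few_c4_sparse (a : rel 'I_N) (E := \sum_x \sum_y adj R a x y) : (0 < N)%N ->
  8 * N%:R ^+ 4 * (c4 a)%:R < E ^+ 4 ->
  \sum_y (\sum_x adj R a x y) ^+ 2 <= 4 * N%:R ^+ 2 /\ E ^+ 2 <= 4 * N%:R ^+ 3.
Proof.
move=> N0 hE.
pose D : R := \sum_x \sum_(x' | x' != x) (codeg a x x')%:R.
have E0 : 0 <= E by do 2?[apply: sumr_ge0 => ? _]; rewrite mxE ler0n.
have D0 : 0 <= D by do 2?[apply: sumr_ge0 => ? _]; rewrite ler0n.
have N1 : 1 <= N%:R :> R by rewrite ler1n.
(* Both sides count pairs of edges with a common head; equal tails give [E], distinct ones [D]. *)
have degE : \sum_y (\sum_x adj R a x y) ^+ 2 = E + D.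
  transitivity (\sum_x \sum_x' (codeg a x x')%:R : R).
    under [RHS]eq_bigr => x _ do under eq_bigr => x' _ do rewrite codegE mxE.
    under [RHS]eq_bigr => x _ do rewrite exchange_big /=.
    rewrite exchange_big; apply: eq_bigr => y _; rewrite expr2 mulr_suml.
    apply: eq_bigr => x _; rewrite mulr_sumr; apply: eq_bigr => x' _.
    by rewrite [(adj R a)^T _ _]mxE.
  rewrite -big_split; apply: eq_bigr => x _; rewrite (bigD1 x) //=.
  by rewrite codegxx.
have h1 : E ^+ 2 <= N%:R * (E + D).
  rewrite -degE; pose u : 'cV[R]_N := \col_y \sum_x adj R a x y; pose one : 'cV[R]_N := const_mx 1.
  have -> : E = dotm one u.
    by rewrite /E exchange_big; apply: eq_bigr => y _; rewrite big_ord1 !mxE mul1r.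
  have -> : \sum_y (\sum_x adj R a x y) ^+ 2 = fnorm u ^+ 2.
    by rewrite fnorm2; apply: eq_bigr => y _; rewrite big_ord1 mxE expr2.
  have -> : N%:R = fnorm one ^+ 2.
    rewrite fnorm2 /dotm; under eq_bigr do rewrite big_ord1 !mxE mulr1.
    by rewrite sumr_const card_ord.
  rewrite -exprMn -[leLHS]real_normK ?num_real // lerXn2r ?nnegrE ?mulr_ge0 ?fnorm_ge0 //.
  exact: ler_norm_dotm.
have h2 : D ^+ 2 <= N%:R ^+ 2 * ((c4 a)%:R + D).
  pose G : 'M[R]_N := \matrix_(x, x') (if x' != x then (codeg a x x')%:R else 0).
  pose one : 'M[R]_N := const_mx 1.
  have -> : D = dotm one G.
    apply: eq_bigr => x _; rewrite big_mkcond; apply: eq_bigr => x' _.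
    by rewrite !mxE mul1r.
  have -> : (c4 a)%:R + dotm one G = fnorm G ^+ 2.
    rewrite fnorm2 c4E -big_split; apply: eq_bigr => x _ /=; rewrite big_mkcond -big_split.
    by apply: eq_bigr => x' _; rewrite !mxE; case: eqP => _ /=; ring.
  have -> : N%:R ^+ 2 = fnorm one ^+ 2.
    rewrite fnorm2 /dotm; under eq_bigr do under eq_bigr do rewrite !mxE mulr1.
    by rewrite !sumr_const card_ord -[RHS]mulr_natl.
  rewrite -exprMn -[leLHS]real_normK ?num_real // lerXn2r ?nnegrE ?mulr_ge0 ?fnorm_ge0 //.
  exact: ler_norm_dotm.
move: (c4 a)%:R hE h2 (ler0n R (c4 a)) => Z hE h2 Z0; rewrite degE.
move: (N%:R) N1 h1 h2 hE => n n1 h1 h2 hE.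
have n0 : 0 < n by apply: lt_le_trans n1.
(* Otherwise [h2] gives D^2 <= 2 n^2 Z. If E <= D, [h1] then contradicts the shortage of 4-cycles;
   if D < E, [h1] gives E <= 2n, which is below D. *)
have hD : D <= 2 * n ^+ 2.
  rewrite leNgt; apply/negP => hD.
  have h3 : D ^+ 2 <= 2 * n ^+ 2 * Z.
    have : 2 * n ^+ 2 * D <= D * D by rewrite ler_wpM2r // ltW.
    rewrite mulrDr in h2; rewrite -expr2; lra.
  have [hED|hED] := leP E D.
    have h4 : E ^+ 2 <= 2 * n * D.
      apply: le_trans h1 _; have : n * E <= n * D by rewrite ler_wpM2l // ltW.
      by rewrite mulrDr; lra.
    have h5 : E ^+ 4 <= 4 * n ^+ 2 * D ^+ 2.
      have -> : 4 * n ^+ 2 * D ^+ 2 = (2 * n * D) ^+ 2 by ring.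
      by rewrite (exprM E 2 2) lerXn2r ?nnegrE ?sqr_ge0 // !mulr_ge0 // ltW.
    have h6 : 4 * n ^+ 2 * D ^+ 2 <= 8 * n ^+ 4 * Z.
      have -> : 8 * n ^+ 4 * Z = 4 * n ^+ 2 * (2 * n ^+ 2 * Z) by ring.
      by rewrite ler_wpM2l // mulr_ge0 ?sqr_ge0.
    by have := le_lt_trans (le_trans h5 h6) hE; rewrite ltxx.
  have Ep : 0 < E by apply: le_lt_trans hED.
  have h4 : E <= 2 * n.
    rewrite -(ler_pM2r Ep) -expr2; apply: le_trans h1 _.
    have : n * D <= n * E by rewrite ler_wpM2l // ltW.
    by rewrite mulrDr; lra.
  have h5 : 2 * n <= 2 * n ^+ 2 by rewrite ler_wpM2l // expr2 ler_peMr // ltW.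
  by have := lt_le_trans hD (le_trans (ltW hED) (le_trans h4 h5)); rewrite ltxx.
have n23 : n ^+ 2 <= n ^+ 3 by rewrite ler_weXn2l.
have hE2 : E ^+ 2 <= 4 * n ^+ 3.
  have h3 : n * D <= 2 * n ^+ 3.
    by rewrite (_ : 2 * n ^+ 3 = n * (2 * n ^+ 2)); [rewrite ler_wpM2l // ltW|ring].
  have [h4|h4] := leP E (2 * n).
    apply: le_trans (_ : (2 * n) ^+ 2 <= _).
      by rewrite lerXn2r ?nnegrE // mulr_ge0 // ltW.
    have -> : (2 * n) ^+ 2 = 4 * n ^+ 2 by ring.
    by rewrite ler_wpM2l.
  have : 2 * n * E <= E * E by rewrite ler_wpM2r // ltW.
  by rewrite mulrDr in h1; rewrite -expr2; lra.
split => //.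
suff : E <= 2 * n ^+ 2 by lra.
have n2p : 0 <= 2 * n ^+ 2 by apply: mulr_ge0 => //; apply: sqr_ge0.
rewrite -(ler_pXn2r (n := 2)) ?nnegrE //.
apply: le_trans hE2 _; have -> : (2 * n ^+ 2) ^+ 2 = 4 * n ^+ 4 by ring.
by rewrite ler_wpM2l // ler_weXn2l.
Qed.

Lemma adj_walks (a : rel 'I_N) (k : nat) x y :
  (adj R a ^+ k) x y = #|[pred s : k.-tuple 'I_N | path a x s && (last x s == y)]|%:R.
Proof.
elim: k x => [|k IH] x.
  rewrite expr0 mxE; case: eqP => [->|h].
    by rewrite (eq_card (_ : _ =i predT)) ?card_tuple // => s; rewrite inE tuple0 /= eqxx.
  by rewrite eq_card0 // => s; rewrite inE tuple0 /=; case: eqP.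
rewrite exprS -mulmxE mxE -sum1_card natr_sum [RHS]big_mkcond /=.
under eq_bigr => z _ do rewrite IH mxE.
rewrite (reindex (fun zs : 'I_N * k.-tuple 'I_N => [tuple of zs.1 :: zs.2])) /=; last first.
  exists (fun s => (thead s, [tuple of behead s])) => [[z s]|s] _ /=.
    by rewrite theadE; congr (_, _); apply: val_inj.
  by rewrite -tuple_eta.
rewrite -(pair_bigA _ (fun (z : 'I_N) (s : k.-tuple 'I_N) =>
  if [tuple of z :: s] \in [pred s : k.+1.-tuple 'I_N | path a x s && (last x s == y)]
  then 1 else 0 : R)) /=.
apply: eq_bigr => z _; rewrite -sum1_card natr_sum mulr_sumr big_mkcond; apply: eq_bigr => s _.
rewrite !inE /=.
by case: (a x z); case: (path a z s); case: (last z s == y); rewrite /= ?mulr1 ?mulr0.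
Qed.

End Graphs.

(** * Points and lines as edges and vertices *)

Section Incidence.
Variables (k : nat) (P : finType) (N : nat) (vx : 'I_k -> P -> 'I_N).
Hypothesis k_gt0 : (0 < k)%N.
Hypothesis vx_class : forall i j p q, vx i p = vx j q -> i = j.
Hypothesis vx_inj : forall i p q,
  vx i p = vx i q -> vx (ordS i) p = vx (ordS i) q -> p = q.

Definition gr (D : {set P}) : rel 'I_N := fun u v =>
  [exists p in D, exists i, (vx i p == u) && (vx (ordS i) p == v)].

Lemma grP (D : {set P}) u v :
  reflect (exists p i, [/\ p \in D, vx i p = u & vx (ordS i) p = v]) (gr D u v).
Proof.
apply: (iffP existsP) => [[p /andP[pD /existsP[i /andP[/eqP h1 /eqP h2]]]]|[p [i [pD h1 h2]]]].
  by exists p, i.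
by exists p; rewrite pD; apply/existsP; exists i; rewrite h1 h2 !eqxx.
Qed.

Definition pts (v : 'I_N) : nat := #|[pred ip : 'I_k * P | vx ip.1 ip.2 == v]|.

Section Degrees.
Variable R : rcfType.

Lemma sum_adj_row (a : rel 'I_N) u : \sum_v adj R a u v = #|[pred v | a u v]|%:R.
Proof.
rewrite -sum1_card natr_sum [RHS]big_mkcond; apply: eq_bigr => v _.
by rewrite mxE inE; case: (a u v).
Qed.

Lemma sum_adj_col (a : rel 'I_N) v : \sum_u adj R a u v = #|[pred u | a u v]|%:R.
Proof.
rewrite -sum1_card natr_sum [RHS]big_mkcond; apply: eq_bigr => u _.
by rewrite mxE inE; case: (a u v).
Qed.

Let fibre (D : {set P}) v := [pred ip : 'I_k * P | (ip.2 \in D) && (vx ip.1 ip.2 == v)].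

(** A vertex on no point of [D] has an empty fibre, so the bound is only asked of lines meeting
    [D]. *)
Let fibre_le (D : {set P}) v (M : nat) :
  (forall p i, p \in D -> (pts (vx i p) <= M)%N) -> (#|fibre D v| <= M)%N.
Proof.
move=> hM; have [[i p] /= /andP[pD /eqP <-]|h0] := pickP (fibre D v); last by rewrite eq_card0.
apply: leq_trans (hM p i pD); apply: subset_leq_card; apply/subsetP => -[j q].
by rewrite !inE /= => /andP[].
Qed.

Lemma outdeg_gr (D : {set P}) (M : nat) v :
  (forall p i, p \in D -> (pts (vx i p) <= M)%N) -> \sum_u adj R (gr D) v u <= M%:R.
Proof.
move=> hM; rewrite sum_adj_row ler_nat; apply: leq_trans (fibre_le v hM).
apply: leq_trans (leq_image_card (fun ip => vx (ordS ip.1) ip.2) _).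
apply: subset_leq_card; apply/subsetP => u; rewrite inE => /grP[p [i [pD h1 h2]]].
by apply/imageP; exists (i, p); rewrite // inE /= pD h1 eqxx.
Qed.

Lemma indeg_gr (D : {set P}) (M : nat) v :
  (forall p i, p \in D -> (pts (vx i p) <= M)%N) -> \sum_u adj R (gr D) u v <= M%:R.
Proof.
move=> hM; rewrite sum_adj_col ler_nat; apply: leq_trans (fibre_le v hM).
apply: leq_trans (leq_image_card (fun ip => vx (ord_pred ip.1) ip.2) _).
apply: subset_leq_card; apply/subsetP => u; rewrite inE => /grP[p [i [pD h1 h2]]].
by apply/imageP; exists (ordS i, p); rewrite /= ?ordSK // inE /= pD h2 eqxx.
Qed.

(** Distinct points on a line lie on distinct lines of the preceding index, by [vx_inj]. *)
Lemma pts_le_indeg v : (pts v)%:R <= \sum_u adj R (gr setT) u v.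
Proof.
rewrite sum_adj_col ler_nat /pts.
rewrite -(card_in_image (f := fun ip => vx (ord_pred ip.1) ip.2)); last first.
  move=> [i p] [j q]; rewrite !inE /= => /eqP h1 /eqP h2 h3.
  have e : i = j by apply: (@vx_class _ _ p q); rewrite h1 h2.
  subst j; congr (_, _); apply: vx_inj h3 _.
  by rewrite !ord_predK h1 h2.
apply: subset_leq_card; apply/subsetP => u /imageP[[i p] h ->]; rewrite !inE /= in h *.
by apply/grP; exists p, (ord_pred i); rewrite inE ord_predK (eqP h).
Qed.

Lemma card_le_edges : #|P|%:R <= \sum_u \sum_v adj R (gr setT) u v.
Proof.
pose i0 := Ordinal k_gt0.
have inj : injective (fun p => (vx i0 p, vx (ordS i0) p)).
  by move=> p q [h1 h2]; apply: vx_inj h1 h2.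
have -> : \sum_u \sum_v adj R (gr setT) u v =
    #|[pred uv : 'I_N * 'I_N | gr setT uv.1 uv.2]|%:R.
  rewrite pair_bigA -sum1_card natr_sum [RHS]big_mkcond; apply: eq_bigr => -[u v] _ /=.
  by rewrite mxE inE /=; case: (gr _ u v).
rewrite ler_nat -(card_image inj predT); apply: subset_leq_card.
apply/subsetP => uv /imageP[p _ ->]; rewrite inE; apply/grP.
by exists p, i0; rewrite inE.
Qed.

Lemma sum_pts (f : 'I_N -> R) : \sum_i \sum_p f (vx i p) = \sum_v (pts v)%:R * f v.
Proof.
rewrite pair_bigA (partition_big (fun ip => vx ip.1 ip.2) xpredT) //=.
apply: eq_bigr => v _; rewrite /pts -sum1_card natr_sum mulr_suml.
by apply: eq_big => [ip|ip /eqP ->]; rewrite ?inE ?mul1r.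
Qed.

(** Each point outside [D] lies on a line with more than [K] points, and summing [pts] over all
    incidences gives the sum of squares. *)
Lemma card_heavy (K : R) (D := [set p | [forall i, (pts (vx i p))%:R <= K]]) : 0 < K ->
  #|~: D|%:R * K <= \sum_v (pts v)%:R ^+ 2.
Proof.
move=> K0; have -> : \sum_v (pts v)%:R ^+ 2 = \sum_v (pts v)%:R * (pts v)%:R :> R.
  by apply: eq_bigr => v _; rewrite expr2.
rewrite -sum_pts exchange_big /= -sum1_card natr_sum mulr_suml big_mkcond.
apply: ler_sum => p _; case: ifP => h; last by apply: sumr_ge0 => i _; rewrite ler0n.
move: h; rewrite mul1r !inE negb_forall => /existsP[i]; rewrite -ltNge => h.
rewrite (bigD1 i) //=; apply: le_trans (ltW h) _; rewrite lerDl.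
by apply: sumr_ge0 => j _; rewrite ler0n.
Qed.

End Degrees.

Definition quads (i : 'I_k) : {set {ffun 'I_4 -> P}} :=
  [set p : {ffun 'I_4 -> P} | injectiveb p &
    [forall j : 'I_4, vx (if odd j then ordS i else i) (p j)
       == vx (if odd j then ordS i else i) (p (ordS j))]].

(** Edges raise the index by one, so the four edges of a 4-cycle share one index [i]. Their points,
    in cyclic order, lie alternately on common lines of index [i] and [ordS i], and are distinct
    because opposite vertices are. [psi] recovers the 4-cycle from them. *)
Lemma c4_gr_le (D : {set P}) : (c4 (gr D) <= \sum_i #|quads i|)%N.
Proof.
pose o j : 'I_4 := inord j.
have -> : (\sum_i #|quads i| = #|[pred ip : 'I_k * {ffun 'I_4 -> P} | ip.2 \in quads ip.1]|)%N.
  rewrite -[RHS]sum1_card [RHS]big_mkcond /=.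
  rewrite -(pair_bigA _ (fun i p => if p \in quads i then 1 else 0)%N).
  by apply: eq_bigr => i _; rewrite -sum1_card big_mkcond.
pose psi (ip : 'I_k * {ffun 'I_4 -> P}) := ((vx ip.1 (ip.2 (o 0%N)), vx ip.1 (ip.2 (o 2%N))),
   (vx (ordS ip.1) (ip.2 (o 1%N)), vx (ordS ip.1) (ip.2 (o 0%N)))).
apply: leq_trans (leq_image_card psi _).
apply: subset_leq_card; apply/subsetP => -[[x x'] [y y']]; rewrite inE /=.
case/and5P => xx yy /grP[p2 [i [d2 x2 y2]]] /grP[p3 [i3 [d3 x3 y3]]].
case/andP => /grP[p1 [i1 [d1 x1 y1]]] /grP[p4 [i4 [d4 x4 y4]]].
have e1 : i1 = i by apply: (@vx_class _ _ p1 p2); rewrite x1 x2.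
have e3 : i3 = i by apply: (can_inj (@ordSK k)); apply: (@vx_class _ _ p3 p2); rewrite y3 y2.
have e4 : i4 = i by apply: etrans e3; apply: (@vx_class _ _ p4 p3); rewrite x4 x3.
subst i1 i3 i4.
pose f := [ffun j : 'I_4 => tnth [tuple p1; p2; p3; p4] j].
apply/imageP; exists (i, f); last first.
  by rewrite /psi /= !ffunE !(tnth_nth p1) /= !inordK //= x1 x3 y1 y2.
rewrite !inE /=; apply/andP; split; last first.
  apply/forallP => -[[|[|[|[|j]]]] hj] //; rewrite !ffunE !(tnth_nth p1) /=.
  - by rewrite x1 x2.
  - by rewrite y2 y3.
  - by rewrite x3 x4.
  - by rewrite y4 y1.
have d12 : p1 != p2 by apply: contraNneq yy => e; rewrite -y1 e y2.
have d13 : p1 != p3 by apply: contraNneq xx => e; rewrite -x1 e x3.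
have d14 : p1 != p4 by apply: contraNneq xx => e; rewrite -x1 e x4.
have d23 : p2 != p3 by apply: contraNneq xx => e; rewrite -x2 e x3.
have d24 : p2 != p4 by apply: contraNneq xx => e; rewrite -x2 e x4.
have d34 : p3 != p4 by apply: contraNneq yy => e; rewrite -y3 e y4.
apply/injectiveP => a b; rewrite !ffunE.
have u : uniq [tuple p1; p2; p3; p4].
  by rewrite /= !inE !negb_or d12 d13 d14 d23 d24 d34.
by rewrite !(tnth_nth p1) => /eqP; rewrite nth_uniq ?size_tuple // => /eqP h; apply: val_inj.
Qed.

Definition ik (m : nat) : 'I_k := Ordinal (ltn_pmod m k_gt0).

Lemma ikS m : ik m.+1 = ordS (ik m).
Proof. by apply: val_inj; rewrite /= -addn1 -modnDml addn1. Qed.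

Lemma ik_val (i : 'I_k) : ik i = i.
Proof. by apply: val_inj; rewrite /= modn_small. Qed.

Lemma ikD m : ik (m + k) = ik m.
Proof. by apply: val_inj; rewrite /= modnDr. Qed.

Definition polys : {set {ffun 'I_k -> P}} :=
  [set p : {ffun 'I_k -> P} | [forall i, vx i (p i) == vx i (p (ordS i))]].

(** Along a closed walk the index advances by one at each step, so the walk amounts to the index [j]
    of its first vertex, whence the factor [k], and the polygon formed by its edges. *)
Lemma walks_gr_le (R : rcfType) (D : {set P}) :
  \tr (adj R (gr D) ^+ k) <= k%:R * #|polys|%:R.
Proof.
pose W := [pred xs : 'I_N * k.-tuple 'I_N | path (gr D) xs.1 xs.2 && (last xs.1 xs.2 == xs.1)].
have -> : \tr (adj R (gr D) ^+ k) = #|W|%:R.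
  rewrite -sum1_card natr_sum big_mkcond.
  rewrite (eq_bigr (fun xs => if (xs.1, xs.2) \in W then 1 else 0)) => [|[x s] _ //].
  rewrite -(pair_bigA _ (fun x s => if (x, s) \in W then 1 else 0 : R)) /=.
  by apply: eq_bigr => x _; rewrite adj_walks -sum1_card natr_sum big_mkcond.
pose psi (jp : 'I_k * {ffun 'I_k -> P}) :=
  (vx jp.1 (jp.2 (ordS jp.1)), [tuple vx (ik (jp.1 + r.+1)) (jp.2 (ik (jp.1 + r.+1))) | r < k]).
have -> : k%:R * #|polys|%:R = #|[pred jp : 'I_k * {ffun 'I_k -> P} | jp.2 \in polys]|%:R :> R.
  rewrite -natrM -[k in (k * _)%N]card_ord -cardX; congr (_%:R); apply: eq_card => -[j p].
rewrite ler_nat; apply: leq_trans (leq_image_card psi _).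
apply: subset_leq_card; apply/subsetP => -[x s]; rewrite inE /= => /andP[hp /eqP hl].
pose v m := nth x (x :: s) (m %% k).
have vr (r : nat) : (r <= k)%N -> nth x (x :: s) r = v r.
  rewrite leq_eqVlt => /orP[/eqP->|h]; last by rewrite /v modn_small.
  rewrite /v modnn /= -[RHS]hl -nth_last size_tuple.
  by case: (k) k_gt0 s {hp hl v} => // k' _ s.
have vS m : gr D (v m) (v m.+1).
  have h := ltn_pmod m k_gt0.
  have -> : v m.+1 = nth x (x :: s) (m %% k).+1.
    by rewrite vr // /v -addn1 -modnDml addn1.
  by move/(pathP x): hp; apply; rewrite size_tuple.
have [P0 [j [_ hj0 hj1]]] := grP _ _ _ (vS 0%N).
have vcl m : exists p i, [/\ vx i p = v m, vx (ordS i) p = v m.+1 & i = ik (j + m)].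
  elim: m => [|m [p [i [h1 h2 h3]]]]; first by exists P0, j; rewrite addn0 ik_val.
  have [q [i' [_ q1 q2]]] := grP _ _ _ (vS m.+1).
  exists q, i'; split => //; rewrite addnS ikS -h3.
  by apply: (@vx_class _ _ q p); rewrite q1 h2.
have {}vcl (m : 'I_k) : exists p, vx (ik (j + m)) p = v m /\ vx (ik (j + m.+1)) p = v m.+1.
  by have [p [i [h1 h2 h3]]] := vcl m; exists p; rewrite addnS ikS -h3.
have [Q hQ] := fin_all_exists vcl.
(* The edge leaving [v m] is a point on the lines of indices j + m and j + m + 1, whereas vertex [i]
   of a polygon lies on the lines of indices i - 1 and i. So m is i - j - 1 modulo k, written here
   without truncated subtraction of a larger number. *)
pose pos (i : 'I_k) : nat := (i + (k - j + k.-1))%N.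
pose f := [ffun i : 'I_k => Q (ik (pos i))].
have jk := ltn_ord j.
have posE (i : 'I_k) : ik (j + (pos i %% k).+1) = i.
  rewrite -[RHS]ik_val; apply: val_inj => /=; rewrite addnS -addSn modnDmr /pos.
  have -> : (j.+1 + (i + (k - j + k.-1)) = i + 2 * k)%N by lia.
  by rewrite addnC modnMDl.
have posS (r : nat) : (r < k)%N -> (pos (ik (j + r.+1)) %% k = r)%N.
  move=> rk; rewrite /pos /= modnDml.
  have -> : (j + r.+1 + (k - j + k.-1) = 2 * k + r)%N by lia.
  by rewrite modnMDl modn_small.
have vk m : v (m %% k)%N = v m by rewrite /v modn_mod.
have vkS m : v (m %% k)%N.+1 = v m.+1 by rewrite /v -addn1 modnDml addn1.
have f1 i : vx i (f i) = v (pos i).+1.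
  by rewrite ffunE; have [_] := hQ (ik (pos i)); rewrite /= posE vkS.
have f2 i : vx i (f (ordS i)) = v (pos i).+1.
  rewrite ffunE; have [+ _] := hQ (ik (pos (ordS i))); rewrite /= vk.
  have e : (pos (ordS i) = (pos i).+1 %[mod k])%N.
    by rewrite /pos /= modnDml -addSn.
  have -> : v (pos (ordS i)) = v (pos i).+1 by rewrite /v e.
  rewrite e => <-; congr (vx _ _).
  rewrite -{1}[i]posE; apply: val_inj => /=.
  by rewrite -[in LHS]addn1 addnA addn1 -addSn !modnDmr addSn addnS.
apply/imageP; exists (j, f); first by rewrite !inE; apply/forallP => i; rewrite f1 f2.
rewrite /psi /=; congr (_, _).
  have e : ((pos j).+1 %% k = 0)%N.
    by rewrite /pos (_ : (j + (k - j + k.-1)).+1 = 2 * k)%N ?modnMl //; lia.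
  by rewrite f2 /v e.
apply: eq_from_tnth => r; rewrite tnth_mktuple f1 /v -addn1 -modnDml posS // addn1.
by rewrite -/(v r.+1) -vr // (tnth_nth x).
Qed.

End Incidence.

(** * Lattice lines *)

(** Clearing the denominator of the slope gives an integer that separates parallel lines. *)
Definition line_key (t : slope) (p : point) : int :=
  if t is Some r then denq r * p.2 - numq r * p.1 else p.1.

Lemma same_line_key (t : slope) (p q : point) :
  same_line t p q = (line_key t p == line_key t q).
Proof.
case: t => [r|] /=; last exact: eq_sym.
have d0 : (denq r)%:~R != 0 :> rat by rewrite intr_eq0 denq_neq0.
rewrite -(inj_eq (mulfI d0)) mulrA [_ * r]mulrC -numqE -!intrM eqr_int.
by apply/eqP/eqP => h; lia.
Qed.

Lemma same_line_inj (t t' : slope) (p q : point) :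
  t <> t' -> same_line t p q -> same_line t' p q -> p = q.
Proof.
move=> tt; rewrite [p]surjective_pairing [q]surjective_pairing.
case: p q => [p1 p2] [q1 q2] /=.
case: t t' tt => [r|] [r'|] //= tt.
- move=> /eqP h /eqP h'; have : (r - r') * (q1 - p1)%:~R = 0 by rewrite mulrBl -h -h' subrr.
  move/eqP; rewrite mulf_eq0 subr_eq0 => /orP[/eqP e|]; first by case: tt; rewrite e.
  rewrite intr_eq0 subr_eq0 => /eqP e; move: h; rewrite e subrr mulr0 => /eqP.
  by rewrite intr_eq0 subr_eq0 => /eqP ->.
- move=> /eqP h /eqP e; move: h; rewrite e subrr mulr0 => /eqP.
  by rewrite intr_eq0 subr_eq0 => /eqP ->.
- by move=> /eqP e /eqP; rewrite e subrr mulr0 => /eqP; rewrite intr_eq0 subr_eq0 => /eqP ->.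
Qed.

Definition slope_height (t : slope) : nat :=
  if t is Some r then (`|numq r| + `|denq r|)%N else 1%N.

Lemma slope_height_gt0 t : (0 < slope_height t)%N.
Proof. by case: t => [r|] //=; rewrite addn_gt0 orbC absz_gt0 denq_neq0. Qed.

Lemma line_key_le (t : slope) (n : nat) (p : point) :
  1 <= p.1 <= n%:Z -> 1 <= p.2 <= n%:Z -> `|line_key t p| <= (slope_height t * n)%N%:Z.
Proof.
case: t p => [r|] [x y] /= hx hy; last by lia.
apply: le_trans (ler_normB _ _) _; rewrite !normrM.
have hx' : `|x| <= n%:Z by lia.
have hy' : `|y| <= n%:Z by lia.
rewrite PoszM PoszD mulrDl addrC !abszE; apply: lerD; exact: ler_wpM2l.
Qed.

Section Lines.
Variables (k : nat) (s : 'I_k -> slope) (n : nat) (S : {fset point}).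
Hypothesis k_gt0 : (0 < k)%N.
Hypothesis s_neq : forall i : 'I_k, s i <> s (ordS i).
Hypothesis S_box : forall p : point, p \in S -> (1 <= p.1 <= n%:Z) /\ (1 <= p.2 <= n%:Z).

Definition height : nat := \sum_i slope_height (s i).

(** For points of the box the shifted key is nonnegative and in range, so neither [absz] nor the
    default of [inord] identifies different lines. *)
Definition line_index (i : 'I_k) (p : S) : 'I_(2 * (height * n)).+1 :=
  inord (absz (line_key (s i) (val p) + (height * n)%N%:Z)).

Definition nlines : nat := #|{: 'I_k * 'I_(2 * (height * n)).+1}|.

(** The index is part of the vertex, so a line used at two indices of equal slope gives two
    vertices. *)
Definition line_of (i : 'I_k) (p : S) : 'I_nlines := enum_rank (i, line_index i p).

Lemma line_of_class i j p q : line_of i p = line_of j q -> i = j.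
Proof. by move/enum_rank_inj => []. Qed.

Lemma line_ofE i p q : (line_of i p == line_of i q) = same_line (s i) (val p) (val q).
Proof.
clear k_gt0 s_neq.
rewrite same_line_key /line_of (inj_eq enum_rank_inj) xpair_eqE eqxx /=.
have hk (r : S) : `|line_key (s i) (val r)| <= (height * n)%N%:Z.
  have [h1 h2] := S_box (valP r); apply: le_trans (line_key_le _ h1 h2) _.
  by rewrite lez_nat leq_mul2r /height (bigD1 i) //= leq_addr orbT.
have := hk p; have := hk q; rewrite /line_index.
move: (line_key _ (val p)) (line_key _ (val q)) (height * n)%N => a b m ha hb.
apply/eqP/eqP => [/(congr1 val) /=|-> //]; rewrite !inordK; lia.
Qed.

Lemma line_of_inj i p q :
  line_of i p = line_of i q -> line_of (ordS i) p = line_of (ordS i) q -> p = q.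
Proof.
move/eqP; rewrite line_ofE => h1 /eqP; rewrite line_ofE => h2.
by apply: val_inj; apply: same_line_inj h1 h2; apply: s_neq.
Qed.

Lemma nlinesE : nlines = (k * (2 * (height * n)).+1)%N.
Proof. by rewrite /nlines card_prod !card_ord. Qed.

Lemma height_gt0 : (0 < height)%N.
Proof. by rewrite /height (bigD1 (Ordinal k_gt0)) //= addn_gt0 slope_height_gt0. Qed.

Lemma nlines_bounds : (0 < n)%N -> (n <= nlines <= k * (2 * height).+1 * n)%N.
Proof.
move=> n0; rewrite nlinesE; have := height_gt0; move: height => h h0; apply/andP; split.
  apply: leq_trans (leq_pmull _ k_gt0); apply: leqW; apply: leq_trans (leq_pmull _ h0) _.
  by rewrite leq_pmull.
by rewrite -mulnA leq_mul2l mulSn mulnA; apply/orP; right; lia.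
Qed.

Lemma polygonsE : polygons S s = polys line_of.
Proof.
apply/setP => p; rewrite !inE; apply: eq_forallb => i.
by rewrite line_ofE.
Qed.

Lemma quads_le i : (#|quads line_of i| <=
  #|nondegenerate_polygons S (tnth [tuple s i; s (ordS i); s i; s (ordS i)])|)%N.
Proof.
apply: subset_leq_card; apply/subsetP => p; rewrite !inE => /andP[/injectiveP pi /forallP hp].
apply/andP; split; last by apply/injectiveP => a b /val_inj /pi.
apply/forallP => j; have := hp j.
have -> : tnth [tuple s i; s (ordS i); s i; s (ordS i)] j = s (if odd j then ordS i else i).
  by case: j => [[|[|[|[|j]]]] hj] //; rewrite (tnth_nth (s i)).
by rewrite line_ofE.
Qed.

Lemma card_polygons_gt0 : (0 < #|` S|)%N -> (0 < #|polygons S s|)%N.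
Proof.
rewrite cardfs_gt0 => /fset0Pn[x xS]; apply/card_gt0P; exists [ffun => [` xS]%fset].
by rewrite polygonsE inE; apply/forallP => i; rewrite !ffunE.
Qed.

End Lines.

(** * Numerical estimates and the final assembly *)

Lemma powR_3half (R : realType) (x : R) : 0 < x -> x `^ (3 / 2) = x * Num.sqrt x.
Proof.
move=> x0; have -> : 3 / 2 = 1 + 2^-1 :> R by field.
rewrite powRD; last by rewrite (gt_eqF x0) implybT.
by rewrite powRr1 ?ltW // powR12_sqrt // ltW.
Qed.

Section Estimates.
Variable R : rcfType.

Lemma quartic_le (H n N sg delta k : R) :
  0 < n -> 0 <= N -> N <= H * n -> 0 <= delta -> 0 <= k -> 0 <= sg ->
  N ^+ 4 * (k * (delta * sg ^+ 4 / n ^+ 4)) <= (H ^+ 4 * k * delta) * sg ^+ 4.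
Proof.
move=> n0 N0 NH d0 k0 s0.
have -> : N ^+ 4 * (k * (delta * sg ^+ 4 / n ^+ 4)) = (k * delta * sg ^+ 4) * (N / n) ^+ 4.
  by field; rewrite gt_eqF.
have -> : H ^+ 4 * k * delta * sg ^+ 4 = (k * delta * sg ^+ 4) * H ^+ 4 by ring.
apply: ler_wpM2l; first by apply: mulr_ge0; [apply: mulr_ge0|apply: exprn_ge0].
have hd : 0 <= N / n by rewrite divr_ge0 // ltW.
have hH : N / n <= H by rewrite ler_pdivrMr.
by apply: lerXn2r; rewrite ?nnegrE // (le_trans hd).
Qed.

Lemma ratio_pow_le (H n N sg w : R) (k : nat) :
  0 < n -> 0 <= N -> N <= H * n -> 0 <= sg -> 0 <= w -> sg <= 2 * N * w ->
  sg ^+ k / n ^+ k <= (2 * H) ^+ k * w ^+ k.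
Proof.
move=> n0 N0 NH s0 w0 hs; rewrite -exprVn -!exprMn.
have h1 : 0 <= sg * n^-1 by rewrite divr_ge0 // ltW.
have h2 : sg * n^-1 <= 2 * H * w.
  rewrite ler_pdivrMr //; apply: le_trans hs _.
  have -> : 2 * H * w * n = 2 * (H * n) * w by ring.
  by apply: ler_wpM2r => //; apply: ler_wpM2l.
by apply: lerXn2r; rewrite ?nnegrE // (le_trans h1).
Qed.

End Estimates.

Theorem corollary1p11 (R : realType) (eps : R) (k : nat) (s : 'I_k -> slope)
    (eps_gt0 : 0 < eps) (k_ge5 : (5 <= k)%N)
    (s_neq : forall i : 'I_k, s i <> s (ordS i)) :
  exists delta : R, 0 < delta /\
    forall (n : nat) (S : {fset point}),
      (1 <= n)%N ->
      (forall p : point, p \in S ->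
         (1 <= p.1 <= n%:Z) /\ (1 <= p.2 <= n%:Z)) ->
      eps * n%:R `^ (3 / 2) <= #|` S|%:R ->
      (forall i : 'I_k,
         #|nondegenerate_polygons S
             (tnth [tuple s i; s (ordS i); s i; s (ordS i)])|%:R
         <= delta * #|` S|%:R ^+ 4 / n%:R ^+ 4) ->
      delta * #|` S|%:R ^+ k / n%:R ^+ k <= #|polygons S s|%:R.
Proof.
have k0 : (0 < k)%N by apply: leq_trans k_ge5.
have kp : 0 < k%:R :> R by rewrite ltr0n.
have [H HE H1] : exists2 H : R, H = (k * (2 * height s).+1)%:R & 1 <= H.
  by eexists; first reflexivity; rewrite ler1n muln_gt0 k0.
have Hp : 0 < H by apply: lt_le_trans H1.
(* From N <= H n and w <= H sqrt n, eps1 N w is at most eps n^(3/2). *)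
have [eps1 eps1E eps1p] : exists2 e, e = eps / H ^+ 2 & 0 < e.
  by eexists; first reflexivity; rewrite divr_gt0 // exprn_gt0.
(* With this [K], at most half of eps1 N w points lie on a line with more than K w points. *)
have [K KE Kp] : exists2 K, K = 8 / eps1 & 0 < K.
  by eexists; first reflexivity; rewrite divr_gt0.
have e1half : 0 < eps1 / 2 by rewrite divr_gt0.
(* The squared Gram norm in [gram_adj] will be at most K^2 N^2 + N^2 + 4 N^2. *)
have Cs4 : 4 <= K ^+ 2 + 5 by have := sqr_ge0 K; lra.
have [delta0 [kap0 [d0p kap0p walks]]] := many_closed_walks e1half Cs4 k_ge5.
(* For w >= W0 the degree bound K w is at most kap0 N / 2, the other half being left for the
   4-cycles. *)
have [W0 W0E W0p] : exists2 W, W = 2 * K / kap0 & 0 < W.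
  by eexists; first reflexivity; rewrite divr_gt0 // mulr_gt0.
have H4p : 0 < k%:R * H ^+ 4 by rewrite mulr_gt0 // exprn_gt0.
have P2H : 0 < (2 * H) ^+ k by rewrite exprn_gt0 // mulr_gt0.
(* [d1] makes 4-cycles scarce enough for [few_c4_sparse], [d2] bounds them by (kap0 N / 2)^2, [d3]
   converts closed walks back into polygons, and [d4] handles small [n]. *)
pose d1 := (16 * (k%:R * H ^+ 4))^-1; pose d2 := kap0 ^+ 2 / (64 * (k%:R * H ^+ 4)).
pose d3 := delta0 / (k%:R * (2 * H) ^+ k); pose d4 := ((2 * H) ^+ k * W0 ^+ k)^-1.
have d1p : 0 < d1 by rewrite invr_gt0 mulr_gt0.
have d2p : 0 < d2 by apply: divr_gt0; [apply: exprn_gt0|apply: mulr_gt0].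
have d3p : 0 < d3 by apply: divr_gt0 => //; apply: mulr_gt0.
have d4p : 0 < d4 by rewrite invr_gt0; apply: mulr_gt0 => //; apply: exprn_gt0.
have [delta [dp dd1 dd2 dd3 dd4]] :
    exists d, [/\ 0 < d, d <= d1, d <= d2, d <= d3 & d <= d4].
  exists (Num.min (Num.min d1 d2) (Num.min d3 d4)).
  by split; rewrite ?lt_min ?d1p ?d2p ?d3p ?d4p // !ge_min lexx ?orbT.
exists delta; split => // n S n1 S_box hS hpoly.
set sg : R := #|` S|%:R in hS hpoly *.
pose N := nlines s n; pose w := Num.sqrt N%:R : R.
have np : 0 < n%:R :> R by rewrite ltr0n.
have /andP[nN NH] := nlines_bounds s k0 n1.
have N0 : (0 < N)%N by apply: leq_trans nN.
have Np : 0 < N%:R :> R by rewrite ltr0n.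
have {}NH : N%:R <= H * n%:R by rewrite HE -natrM ler_nat.
have w0 : 0 < w by rewrite sqrtr_gt0.
have w2 : w ^+ 2 = N%:R by rewrite sqr_sqrtr ?ler0n.
have sg0 : 0 <= sg by rewrite ler0n.
have hNw : eps1 * N%:R * w <= sg.
  apply: le_trans hS; rewrite (powR_3half np) eps1E.
  have hw : w <= H * Num.sqrt n%:R.
    have h0 : 0 <= H * Num.sqrt n%:R by apply: mulr_ge0; [apply: ltW|apply: sqrtr_ge0].
    rewrite -(ler_pXn2r (n := 2)) ?nnegrE ?(ltW w0) // w2 exprMn (sqr_sqrtr (ler0n _ _)).
    apply: le_trans NH _; apply: ler_wpM2r; first exact: ler0n.
    by rewrite expr2 ler_peMr // ltW.
  have -> : eps * (n%:R * Num.sqrt n%:R) = eps / H ^+ 2 * ((H * n%:R) * (H * Num.sqrt n%:R)).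
    by field; rewrite gt_eqF.
  rewrite -mulrA; apply: ler_wpM2l; first by rewrite -eps1E ltW.
  by apply: ler_pM => //; apply: ltW.
have sgp : 0 < sg by apply: lt_le_trans hNw; rewrite !mulr_gt0.
pose vx := @line_of k s n S.
have vcl : forall i j p q, vx i p = vx j q -> i = j := @line_of_class _ _ _ _.
have vinj : forall i p q, vx i p = vx i q -> vx (ordS i) p = vx (ordS i) q -> p = q :=
  line_of_inj s_neq S_box.
pose Q : R := k%:R * (delta * sg ^+ 4 / n%:R ^+ 4).
have c4Q D : (c4 (gr vx D))%:R <= Q.
  apply: (@le_trans _ _ (\sum_(i < k) #|quads vx i|)%:R).
    by rewrite ler_nat; apply: c4_gr_le.
  rewrite natr_sum /Q -[k in k%:R]card_ord mulr_natl -sumr_const; apply: ler_sum => i _.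
  by apply: le_trans (hpoly i); rewrite ler_nat; apply: quads_le.
have hQ : N%:R ^+ 4 * Q <= (H ^+ 4 * k%:R * delta) * sg ^+ 4.
  exact: (quartic_le np (ltW Np) NH (ltW dp) (ltW kp) sg0).
have hd1 : H ^+ 4 * k%:R * delta <= 16^-1.
  apply: le_trans (_ : H ^+ 4 * k%:R * d1 <= _).
    by apply: ler_wpM2l => //; rewrite mulrC ltW.
  by rewrite /d1 le_eqVlt; apply/orP; left; apply/eqP; field; rewrite !gt_eqF.
have [hdeg hE] : \sum_v (\sum_u adj R (gr vx setT) u v) ^+ 2 <= 4 * N%:R ^+ 2 /\ sg <= 2 * N%:R * w.
  have hsE : sg <= \sum_u \sum_v adj R (gr vx setT) u v.
    by rewrite /sg cardfE; apply: card_le_edges.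
  set E := \sum_u _ in hsE.
  have hE4 : sg ^+ 4 <= E ^+ 4 by rewrite lerXn2r ?nnegrE ?(le_trans sg0).
  have [|h1 h2] := @few_c4_sparse R N (gr vx setT) N0.
    apply: lt_le_trans hE4; apply: (@le_lt_trans _ _ (8 * (N%:R ^+ 4 * Q))).
      rewrite -mulrA; apply: ler_wpM2l => //; apply: ler_wpM2l (c4Q _).
      by rewrite exprn_ge0.
    have s4 : 0 < sg ^+ 4 by rewrite exprn_gt0.
    have : H ^+ 4 * k%:R * delta * sg ^+ 4 <= 16^-1 * sg ^+ 4 by rewrite ler_wpM2r // ltW.
    lra.
  split => //; apply: le_trans hsE _.
  have Nw0 : 0 <= 2 * N%:R * w by rewrite !mulr_ge0 // ltW.
  apply: le_trans (ler_norm _) _.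
  rewrite -(ler_pXn2r (n := 2)) ?nnegrE ?normr_ge0 // real_normK ?num_real //.
  by apply: le_trans h2 _; rewrite !exprMn w2 le_eqVlt; apply/orP; left; apply/eqP; ring.
have hratio : delta * sg ^+ k / n%:R ^+ k <= delta * ((2 * H) ^+ k * w ^+ k).
  rewrite -mulrA; apply: ler_wpM2l; first exact: ltW.
  exact: (ratio_pow_le k np (ltW Np) NH sg0 (ltW w0) hE).
apply: le_trans hratio _.
(* For small [w] the lower bound to be proved is at most 1, and a constant sequence is a polygon. *)
have [wW|wW] := ltP w W0.
  apply: (@le_trans _ _ 1); last first.
    by rewrite ler1n; apply: (card_polygons_gt0 s S_box); rewrite -(ltr0n R).
  apply: (@le_trans _ _ (d4 * ((2 * H) ^+ k * W0 ^+ k))).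
    apply: ler_pM => //; [exact: ltW|by apply: mulr_ge0; rewrite ?(ltW P2H) // exprn_ge0 // ltW|].
    apply: ler_wpM2l; first exact: ltW.
    by apply: lerXn2r; rewrite ?nnegrE ltW.
  by rewrite mulVf // gt_eqF // mulr_gt0 // exprn_gt0.
(* Points on overfull lines are removed to bound all degrees; at least half of eps1 N w points
   remain. *)
pose D := [set p : S | [forall i, (pts vx (vx i p))%:R <= K * w]].
have Kw0 : 0 < K * w by apply: mulr_gt0.
have hD : eps1 / 2 * N%:R * w <= #|D|%:R.
  have h1 : #|~: D|%:R * (K * w) <= 4 * N%:R ^+ 2.
    apply: le_trans hdeg; apply: le_trans (card_heavy vx Kw0) _.
    apply: ler_sum => v _; apply: lerXn2r; rewrite ?nnegrE ?ler0n //.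
      by apply: sumr_ge0 => u _; rewrite mxE ler0n.
    exact: pts_le_indeg.
  have h2 : #|~: D|%:R <= eps1 / 2 * N%:R * w.
    rewrite -(ler_pM2r Kw0); apply: le_trans h1 _.
    by rewrite KE -w2 le_eqVlt; apply/orP; left; apply/eqP; field; rewrite gt_eqF.
  have h3 : sg = #|D|%:R + #|~: D|%:R by rewrite -natrD cardsC /sg cardfE.
  have h4 : eps1 / 2 * N%:R * w + eps1 / 2 * N%:R * w = eps1 * N%:R * w by field.
  by lra.
pose M := Num.truncn (K * w).
have MK : M%:R <= K * w by rewrite truncn_le ltW.
have hM : forall p i, p \in D -> (pts vx (vx i p) <= M)%N.
  by move=> p i; rewrite inE => /forallP /(_ i) h; rewrite /M truncn_ge_nat // ltW.
have QN : Q <= 16 * (H ^+ 4 * k%:R * delta) * N%:R ^+ 2.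
  have N4 : 0 < N%:R ^+ 4 :> R by rewrite exprn_gt0.
  rewrite -(ler_pM2l N4); apply: le_trans hQ _.
  have -> : N%:R ^+ 4 * (16 * (H ^+ 4 * k%:R * delta) * N%:R ^+ 2) =
     (H ^+ 4 * k%:R * delta) * (2 * N%:R * w) ^+ 4 by rewrite -w2; ring.
  apply: ler_wpM2l; first by rewrite mulr_ge0 ?(ltW dp) // mulrC ltW.
  by apply: lerXn2r; rewrite ?nnegrE ?sg0 ?(le_trans sg0 hE).
have N2 : 0 <= N%:R ^+ 2 :> R by rewrite exprn_ge0.
have QZ : Q <= (kap0 * N%:R / 2) ^+ 2.
  apply: le_trans QN _.
  have -> : (kap0 * N%:R / 2) ^+ 2 = 16 * (H ^+ 4 * k%:R * d2) * N%:R ^+ 2.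
    by rewrite /d2; field; rewrite !gt_eqF.
  do 2?[apply: ler_wpM2r => // || apply: ler_wpM2l => //].
  by apply: ler_wpM2l => //; rewrite mulrC ltW.
have Q5 : 2 * Q <= 4 * N%:R ^+ 2.
  have : 16 * (H ^+ 4 * k%:R * delta) * N%:R ^+ 2 <= 1 * N%:R ^+ 2 by apply: ler_wpM2r => //; lra.
  by lra.
have Z0 : 0 <= kap0 * N%:R / 2 by rewrite divr_ge0 // mulr_ge0 // ltW.
have kapN : M%:R + kap0 * N%:R / 2 <= kap0 * N%:R.
  have h : K * w <= kap0 * N%:R / 2.
    have -> : kap0 * N%:R / 2 = (kap0 * w / 2) * w by rewrite -w2; field.
    apply: ler_wpM2r; first exact: ltW.
    by move: wW; rewrite W0E ler_pdivrMr // ler_pdivlMr // mulrC [w * _]mulrC.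
  by lra.
have out := outdeg_gr R _ hM.
have ind := indeg_gr R _ hM.
have spA : spread kap0 (adj R (gr vx D))^T.
  exact: (spread_adj out Z0 (le_trans (c4Q D) QZ) kapN).
have spAt : spread kap0 (adj R (gr vx D)).
  (* Transposition exchanges in- and out-degrees and preserves the number of 4-cycles. *)
  rewrite -[adj R _]trmxK (adj_tr _ (gr vx D)); apply: spread_adj Z0 _ kapN.
    by move=> v; apply: le_trans (ind v); apply: ler_sum => u _; rewrite !mxE.
  by rewrite c4_tr; apply: le_trans (c4Q D) QZ.
have gram : fnorm ((adj R (gr vx D))^T *m adj R (gr vx D)) <= (K ^+ 2 + 5) * N%:R.
  have C0 : 0 <= K ^+ 2 + 5 by lra.
  rewrite -(ler_pXn2r (n := 2)) ?nnegrE ?fnorm_ge0 ?(mulr_ge0 C0) //.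
  apply: le_trans (gram_adj (ler0n _ M) out) _.
  have h1 : N%:R * M%:R ^+ 2 <= K ^+ 2 * N%:R ^+ 2.
    have -> : K ^+ 2 * N%:R ^+ 2 = N%:R * (K * w) ^+ 2 by rewrite exprMn w2; ring.
    by apply: ler_wpM2l => //; apply: lerXn2r; rewrite ?nnegrE ?ler0n ?(ltW Kw0).
  have h2 : 2 * (c4 (gr vx D))%:R <= 4 * N%:R ^+ 2 :> R.
    by apply: le_trans Q5; apply: ler_wpM2l.
  have h3 : (K ^+ 2 + 5) * N%:R ^+ 2 <= ((K ^+ 2 + 5) * N%:R) ^+ 2.
    rewrite exprMn; apply: ler_wpM2r => //; rewrite expr2 ler_peMr //; lra.
  by apply: le_trans h3; lra.
(* The degenerate polygon at the point [t], as a closed walk through its [k] lines. *)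
pose c (t : {p : S | p \in D}) i : 'I_N := vx (ik k0 i) (val t).
have kapP : 0 <= kap0 <= kap0 by rewrite (ltW kap0p) lexx.
have := walks N (gr vx D) kap0 N0 kapP spAt spA gram _ c.
have hc1 t i : c t (i + k)%N = c t i by rewrite /c ikD.
have hc2 t i : gr vx D (c t i) (c t i.+1).
  by apply/grP; exists (val t), (ik k0 i); rewrite (valP t) /c ikS.
have hc3 t t' i : c t i = c t' i -> c t i.+1 = c t' i.+1 -> t = t'.
  by rewrite /c ikS => h1 h2; apply: val_inj; apply: vinj h1 h2.
rewrite card_sig => /(_ hc1 hc2 hc3).
have -> : #|[pred x | x \in D]| = #|D| by apply: eq_card.
move=> /(_ hD) hw.
have := le_trans hw (walks_gr_le k0 vcl R D); rewrite -/w -(polygonsE s S_box) => hfin.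
rewrite -(ler_pM2l kp); apply: le_trans hfin.
have -> : k%:R * (delta * ((2 * H) ^+ k * w ^+ k)) = delta * (k%:R * (2 * H) ^+ k) * w ^+ k by ring.
apply: ler_wpM2r; first by rewrite exprn_ge0 // ltW.
by rewrite -ler_pdivlMr // mulr_gt0.
Qed.
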